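(* Let $N$ be an odd positive integer. The number of permutations $u\in S_N$ with $\mathrm{btd}(u)\ge\lceil (N+1)/2\rceil$ is at least $N!\,q_{N+1}(\mathcal E)$, where, for even $M$, $$q_M(\mathcal E)=\frac{2M}{(M+1)2^M}\sum_{\substack{k+\ell=M/2\\ k\ge1,\ \ell\ge0}}\frac1k\binom{2(k-1)}{k-1}\binom{2\ell}{\ell}\left(1-\binom{M}{2\ell}^{-1}\right).$$ Consequently, the fraction of such permutations among all permutations of length $N$ is asymptotically at least $1/\sqrt{\pi N/2}$; that is, $$\liminf_{N\to\infty,\ N\text{ odd}}\ \sqrt{\pi N/2}\cdot\frac{\bigl|\{u\in S_N:\mathrm{btd}(u)\ge\lceil (N+1)/2\rceil\}\bigr|}{N!}\ \ge\ 1.$$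
   Context: $S_N$ is the set of permutations of $\{1,\dots,N\}$, written in one-line notation $u=u_1u_2\cdots u_N$. A block transposition swaps two adjacent nonempty blocks of entries (not necessarily of equal lengths): for some $0\le i<j<k\le N$ it turns $u_1\cdots u_i\,u_{i+1}\cdots u_j\,u_{j+1}\cdots u_k\,u_{k+1}\cdots u_N$ into $u_1\cdots u_i\,u_{j+1}\cdots u_k\,u_{i+1}\cdots u_j\,u_{k+1}\cdots u_N$. The block transposition distance $\mathrm{btd}(u)$ of $u$ (from the identity) is the smallest integer $t$ such that some sequence of $t$ block transpositions turns $u$ into the identity permutation $12\cdots N$, i.e. the number of block transpositions needed to sort $u$. $\mathcal E$ is the set of even positive integers. For even $M$, the quantity $q_M(\mathcal E)$ is the probability that the product of two independent uniformly random $M$-cycles in $S_M$ has only cycles of even length. *)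

(* Defs.v *)
From mathcomp Require Import all_boot all_order all_algebra all_fingroup.

Set Implicit Arguments.
Unset Strict Implicit.
Unset Printing Implicit Defensive.

(* The entry at (0-based) position i of the word of u is u i, so permutations
   act on {0, ..., N-1}. *)
Definition one_line (N : nat) (u : 'S_N) : seq 'I_N := [seq u i | i <- enum 'I_N].

(* For i <= j <= k <= size s, exchanges the blocks of s that occupy the 0-based
   positions [i, j) and [j, k). *)
Definition swap_blocks (T : Type) (i j k : nat) (s : seq T) : seq T :=
  take i s ++ take (k - j) (drop j s) ++ take (j - i) (drop i s) ++ drop k s.

Definition block_transposition (N : nat) : rel 'S_N := fun u v =>
  [exists i : 'I_N.+1, exists j : 'I_N.+1, exists k : 'I_N.+1,
    [&& i < j, j < k & one_line v == swap_blocks i j k (one_line u)]].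

Definition sortable_in (N : nat) (u : 'S_N) (t : nat) : bool :=
  [exists p : t.-tuple 'S_N,
    path (@block_transposition N) u p && (last u p == 1%g)].

Lemma size_one_line N (u : 'S_N) : size (one_line u) = N.
Proof. by rewrite size_map size_enum_ord. Qed.

Lemma nth_one_line N (u : 'S_N) x (i : 'I_N) : nth x (one_line u) i = u i.
Proof. by rewrite (nth_map i) ?size_enum_ord // nth_ord_enum. Qed.

Lemma perm_swap_blocks (T : eqType) i j k (s : seq T) :
  i <= j -> j <= k -> perm_eq (swap_blocks i j k s) s.
Proof.
move=> ij jk; rewrite /swap_blocks.
suff E : s = take i s ++ take (j - i) (drop i s)
           ++ take (k - j) (drop j s) ++ drop k s.
  by rewrite [X in perm_eq _ X]E perm_cat2l perm_catCA.
have -> : drop k s = drop (k - j) (drop j s) by rewrite drop_drop subnK.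
have -> : drop j s = drop (j - i) (drop i s) by rewrite drop_drop subnK.
by rewrite !cat_take_drop.
Qed.

Lemma one_lineP N (s : seq 'I_N) : uniq s -> size s = N ->
  exists u : 'S_N, one_line u = s.
Proof.
move=> us sN.
have inj : injective (fun x : 'I_N => nth x s x).
  move=> x y /eqP; rewrite (set_nth_default x y) ?sN // nth_uniq ?sN //.
  by move=> /eqP /val_inj.
exists (perm inj); case: N s us sN inj => [|N] s us sN inj.
  by rewrite [RHS](size0nil sN); apply: size0nil; rewrite size_one_line.
apply: (@eq_from_nth _ ord0) => [|i]; rewrite size_one_line ?sN // => iN.
by rewrite (nth_one_line _ _ (Ordinal iN)) permE /=; apply: set_nth_default; rewrite sN.
Qed.

Lemma sortable N (u : 'S_N) : exists t, sortable_in u t.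
Proof.
suff /(_ N 0 u erefl) [//|p Hp] : forall d m (v : 'S_N), m + d = N ->
    (forall i : 'I_N, i < m -> v i = i) ->
    exists p, path (@block_transposition N) v p && (last v p == 1%g).
  by exists (size p); apply/existsP; exists (in_tuple p).
elim=> [|d IH] m v mN fix_v.
  exists [::]; apply/eqP/permP => i.
  by rewrite perm1 fix_v //; move: mN (ltn_ord i); rewrite addn0 => ->.
have mltN : m < N by rewrite -mN addnS ltnS leq_addr.
pose x := Ordinal mltN; pose y := (v^-1)%g x.
have vy : v y = x by rewrite /y permKV.
have [xy|xy] := eqVneq y x.
  apply: (IH m.+1) => [|i]; first by rewrite addSnnS.
  rewrite ltnS leq_eqVlt => /orP[/eqP im|]; last exact: fix_v.
  have -> : i = x by apply: val_inj.
  by rewrite -{1}xy.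
have my : m < y.
  rewrite ltnNge leq_eqVlt; apply/negP => /orP[/eqP ym|ym].
    by move/eqP: xy; apply; apply: val_inj.
  by move/eqP: xy; apply; rewrite -(fix_v _ ym) vy.
pose s := swap_blocks m y y.+1 (one_line v).
have sv : perm_eq s (one_line v) by apply: perm_swap_blocks => //; apply: ltnW.
have ss : size s = N by rewrite (perm_size sv) size_one_line.
have us : uniq s.
  rewrite (perm_uniq sv) map_inj_uniq ?enum_uniq //; exact: perm_inj.
have [w ws] := one_lineP us ss.
have [||p /andP[pw lw]] := IH m.+1 w; first by rewrite addSnnS.
  move=> i im; rewrite -(nth_one_line w x i) ws /s /swap_blocks nth_cat.
  rewrite size_takel ?size_one_line ?(ltnW mltN) //.
  move: im; rewrite ltnS leq_eqVlt => /orP[/eqP im|im].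
    rewrite im ltnn subnn subSn // subnn nth_cat.
    rewrite size_takel ?size_drop ?size_one_line ?subn_gt0 //=.
    rewrite nth_take // nth_drop addn0 nth_one_line vy.
    exact: val_inj.
  by rewrite im nth_take // nth_one_line fix_v.
exists (w :: p); rewrite /= pw lw !andbT.
have mN1 : m < N.+1 by rewrite ltnS ltnW.
have yN1 : y < N.+1 by rewrite ltnS ltnW.
apply/existsP; exists (Ordinal mN1); apply/existsP; exists (Ordinal yN1).
have yN2 : y.+1 < N.+1 by rewrite ltnS.
by apply/existsP; exists (Ordinal yN2); rewrite /= my ltnSn ws eqxx.
Qed.

Definition btd (N : nat) (u : 'S_N) : nat := ex_minn (sortable u).

Definition full_cycles (M : nat) : {set 'S_M} :=
  [set s | porbits s == [set [set: 'I_M]]].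

(* Fixed points count as cycles of length 1. *)
Definition cycle_lengths_in (M : nat) (A : pred nat) (s : 'S_M) : bool :=
  [forall C in porbits s, #|C| \in A].

(* The probability that the product of two independent uniformly random
   M-cycles has all its cycle lengths in A. *)
Definition q (R : numFieldType) (M : nat) (A : pred nat) : R :=
  (#|[set ab in setX (full_cycles M) (full_cycles M)
        | cycle_lengths_in A (ab.1 * ab.2)%g]|%:R
   / #|setX (full_cycles M) (full_cycles M)|%:R)%R.

Definition even_pos : pred nat := [pred n | (0 < n) && ~~ odd n].

(* Main.v *)
Require Import Defs.
From mathcomp Require Import all_boot all_order all_algebra all_fingroup.
From mathcomp Require Import all_solvable all_field all_character ring lra zify.

(** Let n = N + 1 be even.

    Lower bound.  Attach to u the cycle (0 u_1 ... u_N) of {0, ..., N}, written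
    word_cycle u, and multiply it by the inverse of (0 1 ... N).  The result,
    cycle_graph_perm u, is the identity when u is.  A block transposition
    changes the successor of three entries only, so it changes cycle_graph_perm u
    at three points, and the number of odd cycles of a permutation changes by at
    most 2 under such a perturbation (odd_cycles_perturb).  As the identity has n
    odd cycles, a permutation u whose cycle_graph_perm has none is at distance at
    least n / 2.  Since u |-> word_cycle u is a bijection onto the n-cycles, and
    the n-cycles form one conjugacy class, these u are N! q_n in number.

    Formula for q_n.  The characters of the symmetric group that do not vanish on
    the n-cycles are those of the hooks.  They are obtained here from
    prod_C (1 - X^|C|) / (1 - X), the product ranging over the cycles C of w: its
    coefficients are virtual characters, because prod_C (1 + X^|C|) enumerates the
    w-stable subsets and the product of prod_C (1 - X^|C|) with it is the former
    at X^2; and they are orthonormal by the exponential formula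
    (sum_porbits).  So they are irreducible characters up to sign, and
    generalized orthogonality gives the convolution square of the indicator of the
    n-cycles (card_one_cycle_product).  A second use of the exponential formula sums
    it over the permutations with even cycles only: the generating function is
    ((1 - X^2 x^2) / (1 - x^2))^(1/2), whence the central binomial coefficients,
    and an alternating sum of inverse binomial coefficients telescopes.

    Asymptotics.  In the formula, the main part is the coefficient
    C(2m, m) / 4^m of (1 - x)^(-1/2), where n = 2m, up to an error of order 1 / n
    that comes from the inverse binomial coefficients.  The inequality of Wallis
    bounds this coefficient from below by (pi (m + 1/2))^(-1/2). *)

Set Implicit Arguments.
Unset Strict Implicit.
Unset Printing Implicit Defensive.

Import Order.TTheory GRing.Theory Num.Theory.
Local Open Scope ring_scope.

(** * Cycles of a permutation *)

Section Porbits.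
Variable T : finType.
Implicit Types (A B : {set T}) (s t w : {perm T}).

Lemma porbit_closed s B c :
  {in B, forall z, s z \in B} -> c \in B -> porbit s c \subset B.
Proof.
move=> sB Bc; apply/subsetP => z /porbitP[k ->].
elim: k => [|k IH]; first by rewrite expg0 perm1.
by rewrite expgSr permM sB.
Qed.

Lemma mem_porbit_succ s x y : y \in porbit s x -> s y \in porbit s x.
Proof. by case/porbitP => k ->; rewrite -permM -expgSr mem_porbit. Qed.

(** By finiteness, s maps B onto B, so no point outside B enters B. *)
Lemma closed_setC s B :
  {in B, forall z, s z \in B} -> {in ~: B, forall z, s z \in ~: B}.
Proof.
move=> sB z; rewrite !inE; apply: contra => Bsz.
have /subsetP := porbit_closed sB Bsz; apply.
by rewrite porbit_sym mem_porbit_succ ?porbit_id.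
Qed.

Lemma eq_in_porbit s t B c :
  {in B, forall z, s z \in B} -> {in B, s =1 t} -> c \in B ->
  porbit s c = porbit t c.
Proof.
move=> sB st Bc.
have E k : (s ^+ k)%g c = (t ^+ k)%g c /\ (s ^+ k)%g c \in B.
  elim: k => [|k [IH1 IH2]]; first by rewrite !expg0 perm1.
  by rewrite !expgSr !permM sB // -IH1 st.
by apply/setP => z; apply/porbitP/porbitP => -[k ->]; exists k; case: (E k).
Qed.

Lemma porbit_fix s x : s x = x -> porbit s x = [set x].
Proof.
move=> sx; apply/eqP; rewrite eqEsubset sub1set porbit_id andbT.
by apply: porbit_closed; rewrite ?set11 // => z /set1P ->; rewrite sx set11.
Qed.

Lemma perm_on_fix A s x : perm_on A s -> s x = x -> perm_on (A :\ x) s.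
Proof.
move=> /subsetP As sx; apply/subsetP => z; rewrite !inE => sz.
rewrite (As z sz) andbT; apply: contraNneq sz => ->; exact/eqP.
Qed.

Lemma perm_on_tpermM A x y w :
  x \in A -> y \in A -> perm_on A (tperm x y * w)%g = perm_on A w.
Proof.
move=> xA yA; have txy : perm_on A (tperm x y).
  by apply/subsetP => z; rewrite inE; case: tpermP => [-> //|-> //|_ _]; rewrite eqxx.
apply/idP/idP => [Aw|]; last exact: perm_onM.
by rewrite -[w]mul1g -(tperm2 x y) -mulgA perm_onM.
Qed.

Section Delete.
Variables (A : {set T}) (a x : T) (w : {perm T}).
Hypotheses (neq_ax : a != x) (Aw : perm_on (A :\ x) w).
Let s := (tperm a x * w)%g.

Let wx : w x = x. Proof. by apply: (out_perm Aw); rewrite !inE eqxx. Qed.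

Let xnota : x \notin porbit w a.
Proof.
by rewrite porbit_sym (porbit_fix wx) inE.
Qed.

Let sB : {in ~: (x |: porbit w a), w =1 s}.
Proof.
move=> z; rewrite !inE negb_or => /andP[zx za].
rewrite permM tpermD // eq_sym //; apply: contraNneq za => ->; exact: porbit_id.
Qed.

Let Bclosed : {in ~: (x |: porbit w a), forall z, w z \in ~: (x |: porbit w a)}.
Proof.
apply: closed_setC => z /setU1P[->|za]; first by rewrite wx setU11.
by rewrite setU1r // mem_porbit_succ.
Qed.

Lemma porbit_delete_out c : c \notin x |: porbit w a -> porbit s c = porbit w c.
Proof. by move=> cB; rewrite (eq_in_porbit Bclosed sB) // inE. Qed.

(** The permutation tperm a x * w sends a to x and x to w a: when w fixes x, it
    is w with x inserted in the cycle of a, right after a. *)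
Lemma porbit_delete : porbit s a = x |: porbit w a.
Proof.
apply/eqP; rewrite eqEsubset; apply/andP; split.
  suff : porbit s a \subset ~: ~: (x |: porbit w a) by rewrite setCK.
  apply: porbit_closed; last by rewrite !inE porbit_id orbT.
  apply: closed_setC => z Bz; rewrite -sB //; exact: Bclosed.
have sa : s a = x by rewrite permM tpermL.
rewrite subUset sub1set; apply/andP; split.
  by rewrite -sa mem_porbit_succ ?porbit_id.
apply/subsetP => _ /porbitP[k ->].
elim: k => [|k IH]; first by rewrite expg0 perm1 porbit_id.
rewrite expgSr permM; set z := (w ^+ k)%g a in IH *.
have zx : z != x.
  by apply: contraNneq xnota => <-; apply: mem_porbit.
have [->|za] := eqVneq z a.
  have -> : w a = s x by rewrite permM tpermR.
  rewrite -sa.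
  by rewrite !mem_porbit_succ ?porbit_id.
have -> : w z = s z by rewrite permM tpermD // eq_sym.
exact: mem_porbit_succ.
Qed.

Lemma porbits_delete :
  (porbit s @: A) :\ porbit s a = (porbit w @: (A :\ x)) :\ porbit w a.
Proof.
apply/setP => C; rewrite !inE; apply/andP/andP => -[Ca /imsetP[c cA CE]].
  have cB : c \notin x |: porbit w a.
    by rewrite -porbit_delete; apply: contra Ca; rewrite CE eq_porbit_mem.
  have Ew : C = porbit w c by rewrite CE porbit_delete_out.
  split; first by rewrite Ew eq_porbit_mem; apply: contra cB => ?; rewrite setU1r.
  apply/imsetP; exists c => //; rewrite !inE cA andbT.
  by apply: contraNneq cB => ->; rewrite setU11.
have cB : c \notin x |: porbit w a.
  move: cA Ca; rewrite CE eq_porbit_mem !inE => /andP[cx _] ca.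
  by rewrite negb_or cx.
have Es : C = porbit s c by rewrite CE porbit_delete_out.
split; first by rewrite Es eq_porbit_mem porbit_delete.
by rewrite Es imset_f //; case/setD1P: cA.
Qed.

End Delete.
End Porbits.

(** * The exponential formula *)

Section CycleIndex.
Variable R : comNzRingType.
Implicit Types (f g a b : nat -> R).

(** Says that a is the sequence of coefficients of exp (\sum_k f k x^k / k).  In
    this form, the logarithmic derivative of the series, there is no denominator
    and the relation makes sense over any commutative ring. *)
Definition exp_rec f a :=
  a 0%N = 1 /\ forall n, n%:R * a n = \sum_(k < n) f k.+1 * a (n - k.+1)%N.

Section Weights.
Variable T : finType.
Implicit Types (A : {set T}) (w : {perm T}).

Definition cycle_weight f A w : R := \prod_(C in porbit w @: A) f #|C|.
(** The cycle of x has a weight function of its own, so that shortening this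
    cycle amounts to shifting g. *)
Definition marked_weight f g x A w : R :=
  g #|porbit w x| * \prod_(C in (porbit w @: A) :\ porbit w x) f #|C|.

Lemma marked_weightE f x A w :
  x \in A -> marked_weight f f x A w = cycle_weight f A w.
Proof.
by move=> xA; rewrite /cycle_weight (big_setD1 (porbit w x)) // imset_f.
Qed.

Lemma sum_cycle_weight0 f : \sum_(w | perm_on set0 w) cycle_weight f (set0 : {set T}) w = 1.
Proof.
rewrite (big_pred1 (1%g : {perm T})); first by rewrite /cycle_weight imset0 big_set0.
move=> w; apply/idP/eqP => [w0|->]; last exact: perm_on1.
by apply/permP => z; rewrite perm1 (out_perm w0) ?inE.
Qed.

(** Induction on A.  The permutations that fix x give the term k = 0.  For the
    others, deleting y = w x from its cycle shortens the cycle of x by one, which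
    replaces g by its shift, and each of the #|A| - 1 choices of y gives the same
    sum over the permutations of A :\ y. *)
Lemma sum_marked_weight f a g x A : exp_rec f a -> x \in A ->
  \sum_(w | perm_on A w) marked_weight f g x A w
  = (#|A|.-1)`!%:R * \sum_(k < #|A|) g k.+1 * a (#|A| - k.+1)%N.
Proof.
move=> [a0 aS].
move En : #|A| => n; elim: n A En x g => [|n IH] A cA x g xA.
  by move: xA; rewrite (cards0_eq cA) inE.
have cAD y : y \in A -> #|A :\ y| = n.
  by move=> yA; apply/eqP; rewrite -eqSS -cA (cardsD1 y A) yA.
rewrite (partition_big (fun w : {perm T} => w x) (mem A)) /=; last first.
  by move=> w Aw; rewrite perm_closed.
rewrite (bigD1 x) //= big_ord_recl /= mulrDr; congr (_ + _).
  transitivity (\sum_(w | perm_on (A :\ x) w) g 1%N * cycle_weight f (A :\ x) w).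
    apply: eq_big => w.
      apply/andP/idP => [[Aw /eqP wx]|Aw]; first exact: perm_on_fix.
      split; first by apply: subset_trans Aw _; exact: subD1set.
      by rewrite (out_perm Aw) // !inE eqxx.
    move=> /andP[Aw /eqP wx]; rewrite /marked_weight (porbit_fix wx) cards1.
    congr (_ * _); apply: eq_bigl => C; rewrite in_setD1.
    apply/andP/idP => [[Cx /imsetP[c cA' CE]]|/imsetP[c /setD1P[cx cA'] ->]].
      rewrite CE imset_f // !inE cA' andbT.
      by apply: contraNneq Cx => cx; rewrite CE cx porbit_fix.
    split; last exact: imset_f.
    by rewrite -(porbit_fix wx) eq_porbit_mem (porbit_fix wx) inE.
  rewrite -mulr_sumr mulrCA; congr (_ * _).
  case: (set_0Vmem (A :\ x)) => [AD0|[y yA]].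
    have n0 : n = 0%N by rewrite -(cAD x xA) AD0 cards0.
    by rewrite AD0 sum_cycle_weight0 n0 subn1 /= a0 mulr1.
  rewrite -(eq_bigr _ (fun w _ => @marked_weightE f y (A :\ x) w yA)).
  rewrite (IH _ (cAD x xA)) // -aS subn1 /=.
  have : (0 < n)%N by rewrite -(cAD x xA); apply/card_gt0P; exists y.
  by case: n {IH cA cAD} => // n _; rewrite mulrA -natrM mulnC -factS.
transitivity (\sum_(y in A :\ x)
   ((n.-1)`!%:R * \sum_(k < n) g k.+2 * a (n - k.+1)%N)).
  apply: eq_big => y; first by rewrite !inE andbC.
  move=> /andP[yA yx].
  rewrite (reindex_inj (mulgI (tperm x y))) /=.
  rewrite -(IH _ (cAD y yA) x (fun k => g k.+1)); last by rewrite !inE eq_sym yx.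
  have onE w : perm_on A (tperm x y * w)%g && (w y == y) = perm_on (A :\ y) w.
    rewrite perm_on_tpermM //; apply/andP/idP => [[Aw /eqP wy]|Aw].
      exact: perm_on_fix.
    split; last by rewrite (out_perm Aw) // !inE eqxx.
    by apply: subset_trans Aw _; exact: subD1set.
  apply: eq_big => w; rewrite permM tpermL onE // => Aw'.
  have wy : w y = y by rewrite (out_perm Aw') // !inE eqxx.
  rewrite eq_sym in yx.
  rewrite /marked_weight (porbits_delete yx Aw') (porbit_delete yx Aw').
  rewrite cardsU1 porbit_sym (porbit_fix wy) inE yx add1n //.
rewrite sumr_const cAD // -[X in X = _]mulr_natl mulrA.
case: n {IH cA cAD} => [|n]; first by rewrite !big_ord0 !mulr0.
by rewrite -natrM -factS; congr (_ * _); apply: eq_bigr => i _; rewrite subSS.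
Qed.

(** The exponential formula, obtained by marking an arbitrary point of A with the
    weight f itself. *)
Theorem sum_cycle_weight f a A : exp_rec f a ->
  \sum_(w | perm_on A w) cycle_weight f A w = #|A|`!%:R * a #|A|.
Proof.
move=> fa; case: (set_0Vmem A) => [->|[x xA]].
  by rewrite sum_cycle_weight0 cards0 fact0 mul1r; case: fa.
rewrite -(eq_bigr _ (fun w _ => marked_weightE f w xA)).
rewrite (sum_marked_weight f fa) //; case: (fa) => _ <-.
have : (0 < #|A|)%N by apply/card_gt0P; exists x.
by case: #|A| => // n _; rewrite mulrA -natrM mulnC -factS.
Qed.

Corollary sum_porbits f a : exp_rec f a ->
  \sum_(w : {perm T}) \prod_(C in porbits w) f #|C| = #|T|`!%:R * a #|T|.
Proof.
move=> fa; rewrite -cardsT -(sum_cycle_weight _ fa); apply: eq_big => w.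
  by symmetry; apply/subsetP => z _; rewrite inE.
suff -> : porbits w = porbit w @: [set: T] by [].
by apply/setP => D; apply/imsetP/imsetP => -[z _ ->]; exists z.
Qed.

End Weights.

Definition cauchy_prod a b n : R := \sum_(i < n.+1) a i * b (n - i)%N.

(** The exponential turns sums into products; on coefficients, this is the
    product rule. *)
Lemma exp_rec_cauchy_prod f g a b : exp_rec f a -> exp_rec g b ->
  exp_rec (fun k => f k + g k) (cauchy_prod a b).
Proof.
move=> [a0 aS] [b0 bS]; split; first by rewrite /cauchy_prod big_ord_recl big_ord0 a0 b0 mulr1 addr0.
have H f' a' c n : (forall n, n%:R * a' n = \sum_(k < n) f' k.+1 * a' (n - k.+1)%N) ->
    \sum_(i < n.+1) i%:R * a' i * c (n - i)%N = \sum_(k < n) f' k.+1 * cauchy_prod a' c (n - k.+1)%N.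
  move=> aS'.
  transitivity (\sum_(i < n.+1) \sum_(k < n | (k < i)%N)
      f' k.+1 * a' (i - k.+1)%N * c (n - i)%N).
    apply: eq_bigr => i _; rewrite aS' mulr_suml (big_ord_widen n (fun k =>
      f' k.+1 * a' (i - k.+1)%N * c (n - i)%N)) //.
    by rewrite -ltnS.
  rewrite (exchange_big_dep xpredT) //=; apply: eq_bigr => k _.
  rewrite /cauchy_prod mulr_sumr -(big_mkord (fun i => (k < i)%N)
    (fun i => f' k.+1 * a' (i - k.+1)%N * c (n - i)%N)).
  rewrite -(big_mkord xpredT (fun i => f' k.+1 * (a' i * c (n - k.+1 - i)%N))).
  rewrite (big_cat_nat _ (n := k.+1)) //=; last by rewrite ltnS ltnW.
  rewrite big_nat_cond big_pred0 ?add0r; last first.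
    by move=> i; rewrite /= ltnS; case: leqP.
  rewrite -{1}[k.+1]add0n big_addn subSn ?subSS //.
  rewrite -(subSn (ltn_ord k)) subSS.
  apply: eq_big => [i|i _]; first by rewrite addnS ltnS leq_addl.
  by rewrite addnK -mulrA -subnDA addnC.
move=> n; transitivity (\sum_(i < n.+1) i%:R * a i * b (n - i)%N +
    \sum_(i < n.+1) a i * ((n - i)%:R * b (n - i)%N)).
  rewrite /cauchy_prod mulr_sumr -big_split; apply: eq_bigr => i _ /=.
  have -> : n%:R = i%:R + (n - i)%:R :> R by rewrite -natrD subnKC // -ltnS.
  by rewrite mulrDl mulrA; congr (_ + _); rewrite mulrCA.
rewrite (H f a b n aS).
have cC c d n' : cauchy_prod c d n' = cauchy_prod d c n'.
  rewrite /cauchy_prod (reindex_inj rev_ord_inj); apply: eq_bigr => i _ /=.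
  have le_in : (i <= n')%N by rewrite -ltnS.
  by rewrite subSS (subKn le_in) mulrC.
have -> : \sum_(i < n.+1) a i * ((n - i)%:R * b (n - i)%N)
   = \sum_(i < n.+1) i%:R * b i * a (n - i)%N.
  rewrite (reindex_inj rev_ord_inj); apply: eq_bigr => i _ /=.
  have le_in : (i <= n)%N by rewrite -ltnS.
  by rewrite subSS (subKn le_in) mulrC.
rewrite (H g b a n bS) -big_split; apply: eq_bigr => k _ /=.
by rewrite mulrDl (cC b a).
Qed.
End CycleIndex.

(** * Exterior powers as virtual characters *)

Section FixedPointCharacter.
Variables (gT : finGroupType) (X : finType) (to : {action gT &-> X}).
Variables (G : {group gT}) (S : {set X}).
Hypothesis actsGS : [acts G, on S | to]%g.

Definition action_mx (x : gT) : 'M[algC]_#|S| :=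
  \matrix_(i, j) (to (enum_val i) x == enum_val j)%:R.

Lemma action_mx_repr : mx_repr G action_mx.
Proof.
split=> [|x y xG yG]; apply/matrixP => i j; rewrite !mxE.
  by rewrite act1 (inj_eq enum_val_inj).
have xS : to (enum_val i) x \in S by rewrite (acts_act actsGS) // enum_valP.
rewrite (bigD1 (enum_rank_in xS (to (enum_val i) x))) //= !mxE enum_rankK_in //.
rewrite eqxx mul1r actM big1 ?addr0 // => k nk; rewrite !mxE.
case: eqP => [xk|]; last by rewrite mul0r.
by move: nk; rewrite -(inj_eq enum_val_inj) enum_rankK_in // xk eqxx.
Qed.

Canonical action_repr := MxRepresentation action_mx_repr.

(** The trace of a permutation matrix counts fixed points. *)
Lemma fixed_point_char : exists2 chi : 'CF(G), chi \is a character
  & {in G, forall x, chi x = #|'Fix_(S | to)[x]%g|%:R}.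
Proof.
exists (cfRepr action_repr); first exact: cfRepr_char.
move=> x xG; rewrite cfunE xG mulr1n /mxtrace.
rewrite (eq_bigr (fun i => (to (enum_val i) x == enum_val i)%:R)); last first.
  by move=> i _; rewrite mxE.
rewrite -(big_enum_val (fun a => (to a x == a)%:R)) /= -natr_sum -big_mkcondr sum1_card.
by congr _%:R; apply: eq_card => a; rewrite !inE sub1set inE.
Qed.
End FixedPointCharacter.

Lemma coef_expr_1subX (R : comNzRingType) m k :
  ((1 - 'X) ^+ m : {poly R})`_k = (-1) ^+ k * 'C(m, k)%:R.
Proof.
elim: m k => [|m IH] k.
  by rewrite expr0 coef1 bin0n; case: k => [|k]; rewrite ?mulr1 ?mulr0 // expr0 mulr1.
rewrite exprS mulrBl mul1r coefB coefXM IH; case: k => [|k] /=.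
  by rewrite !bin0 subr0.
by rewrite IH binS natrD mulrDr exprS mulN1r !mulNr.
Qed.

Section Exterior.
Local Open Scope group_scope.
Local Open Scope ring_scope.
Variable T : finType.
Implicit Types (w : {perm T}) (A : {set T}).
Let G := [set: {perm T}]%G.

Lemma partition_porbits w : partition (porbits w) [set: T].
Proof.
apply/and3P; split.
- apply/eqP/setP => z; rewrite in_setT; apply/bigcupP.
  by exists (porbit w z); rewrite ?imset_f ?porbit_id.
- apply/trivIsetP => _ _ /imsetP[x _ ->] /imsetP[y _ ->] ne.
  apply/pred0P => z /=; apply/negbTE; apply: contra ne => /andP[].
  by rewrite -!eq_porbit_mem => /eqP <- /eqP <-.
by apply/imsetP => -[x _ E]; have := porbit_id w x; rewrite -E inE.
Qed.

Lemma cover_porbits w A : w @: A = A -> cover (porbit w @: A) = A.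
Proof.
move=> wA; apply/setP => z; apply/bigcupP/idP => [[_ /imsetP[c cA ->]]|zA].
  apply/subsetP; apply: porbit_closed => // y yA; rewrite -wA; exact: imset_f.
by exists (porbit w z); rewrite ?imset_f ?porbit_id.
Qed.

Lemma imset_cover_porbits w (P : {set {set T}}) :
  P \subset porbits w -> w @: cover P = cover P /\ porbit w @: cover P = P.
Proof.
move=> /subsetP Pw; split.
  apply/eqP; rewrite eqEcard card_imset ?leqnn ?andbT; last exact: perm_inj.
  apply/subsetP => _ /imsetP[z /bigcupP[C CP zC] ->].
  apply/bigcupP; exists C => //; have /imsetP[c _ CE] := Pw _ CP.
  by rewrite CE mem_porbit_succ -?CE.
have E z C : C \in P -> z \in C -> porbit w z = C.
  move=> /Pw /imsetP[c _ ->]; rewrite -eq_porbit_mem => /eqP //.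
apply/setP => C; apply/imsetP/idP => [[z /bigcupP[D DP zD] ->]|CP].
  by rewrite (E z D).
have /imsetP[c _ CE] := Pw _ CP; exists c.
  by apply/bigcupP; exists C; rewrite // CE porbit_id.
by rewrite CE.
Qed.

(** The w-stable sets are the unions of cycles of w. *)
Lemma prod_porbits_subsets (R : comNzRingType) (y : R) w :
  \prod_(C in porbits w) (1 + y ^+ #|C|) = \sum_(A : {set T} | w @: A == A) y ^+ #|A|.
Proof.
under eq_bigr => C _ do rewrite addrC.
rewrite big_mkcond /= (eq_bigr (fun C : {set T} =>
  (if C \in porbits w then y ^+ #|C| else 0) + 1)); last first.
  by move=> C _; case: ifP; rewrite ?add0r.
rewrite bigA_distr (bigID (fun P : {set {set T}} => P \subset porbits w)) /=.
rewrite [X in _ + X]big1 ?addr0; last first.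
  move=> P /subsetPn[C CP Cw]; rewrite (bigD1 C) //= CP (negbTE Cw) mul0r //.
rewrite (reindex_onto (fun A => porbit w @: A) (fun P => cover P)) /=; last first.
  by move=> P /imset_cover_porbits[].
apply: eq_big => A.
  apply/andP/eqP => [[wA /eqP cA]|wA]; last first.
    rewrite cover_porbits // eqxx; split=> //.
    by apply/subsetP => _ /imsetP[z _ ->]; apply: imset_f.
  by rewrite -cA; case: (imset_cover_porbits wA).
move=> /andP[wA /eqP cA].
transitivity (\prod_(C in porbit w @: A) y ^+ #|C|).
  rewrite [RHS]big_mkcond; apply: eq_bigr => C _.
  by case: ifP => // CA; rewrite (subsetP wA).
rewrite prodrXr; congr (_ ^+ _).
have /eqP := trivIsetS wA (partition_trivIset (partition_porbits w)).
by rewrite cA.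
Qed.

(** The polynomial det (1 - X P) for the permutation matrix P of w, whose
    coefficients are, up to sign, the characters of the exterior powers of the
    permutation representation. *)
Definition ext_poly w : {poly algC} := \prod_(C in porbits w) (1 - 'X^#|C|).
(** The generating polynomial, by size, of the w-stable subsets, in view of
    prod_porbits_subsets. *)
Definition subset_poly w : {poly algC} := \prod_(C in porbits w) (1 + 'X^#|C|).

Lemma subset_poly_char k : exists2 chi : 'CF(G), chi \is a character
  & forall w, chi w = (subset_poly w)`_k.
Proof.
pose S := [set A : {set T} | #|A| == k].
have actsS : [acts G, on S | 'P^*]%g.
  by apply/actsP => w _ A; rewrite !inE card_setact.
have [chi chi_char chiE] := fixed_point_char actsS; exists chi => // w.
rewrite chiE ?inE // /subset_poly prod_porbits_subsets coef_sum.
under eq_bigr => A _ do rewrite coefXn.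
rewrite -natr_sum -big_mkcondr /= sum1_card; congr _%:R; apply: eq_card => A.
by rewrite !inE sub1set inE unfold_in andbC [k == _]eq_sym.
Qed.

(** Ties the coefficients of ext_poly, which involve signs, to permutation
    characters, and so avoids the construction of exterior powers. *)
Lemma ext_subset_poly w : ext_poly w * subset_poly w = ext_poly w \Po 'X^2.
Proof.
rewrite /ext_poly /subset_poly -big_split /= rmorph_prod; apply: eq_bigr => C _.
rewrite -subr_sqr expr1n rmorphB /= rmorph1; congr (_ - _).
by rewrite rmorphXn /= comp_polyX -!exprM mulnC.
Qed.

Lemma ext_poly0 w : (ext_poly w)`_0 = 1.
Proof.
rewrite -horner_coef0 /ext_poly horner_prod big1 // => _ /imsetP[x _ ->].
by rewrite !hornerE expr0n (negbTE (card_porbit_neq0 w x)) subr0.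
Qed.

Lemma subset_poly0 w : (subset_poly w)`_0 = 1.
Proof.
rewrite -horner_coef0 /subset_poly horner_prod big1 // => _ /imsetP[x _ ->].
by rewrite !hornerE expr0n (negbTE (card_porbit_neq0 w x)) addr0.
Qed.

(** As subset_poly w has constant term 1, ext_subset_poly expresses each
    coefficient of ext_poly w through permutation characters and coefficients of
    lower degree, by a formula that does not depend on w. *)
Lemma ext_poly_vchar k : exists2 phi : 'CF(G), phi \in 'Z[irr G]
  & forall w, phi w = (ext_poly w)`_k.
Proof.
elim/ltn_ind: k => -[|k] IH.
  by exists 1 => [|w]; rewrite ?cfun1_vchar // ext_poly0 cfun1E inE.
have [phi Zphi phiE] : exists2 phi : 'I_k.+1 -> 'CF(G),
    forall j, phi j \in 'Z[irr G] & forall j w, phi j w = (ext_poly w)`_j.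
  exact: (fin_all_exists2 (fun j : 'I_k.+1 => IH j (ltn_ord j))).
have [chi Zchi chiE] : exists2 chi : 'I_k.+2 -> 'CF(G),
    forall j, chi j \in 'Z[irr G] & forall j w, chi j w = (subset_poly w)`_j.
  have sub_vchar j : exists2 chi : 'CF(G), chi \in 'Z[irr G]
      & forall w, chi w = (subset_poly w)`_j.
    by have [chi ? ?] := subset_poly_char j; exists chi => //; apply: char_vchar.
  exact: (fin_all_exists2 (fun j : 'I_k.+2 => sub_vchar j)).
have [psi Zpsi psiE] : exists2 psi : 'CF(G), psi \in 'Z[irr G]
    & forall w, psi w = (ext_poly w \Po 'X^2)`_k.+1.
  have [] := boolP (2 %| k.+1)%N => [ek|ok].
    have [|psi Zpsi psiE] := IH (k.+1 %/ 2)%N; first exact: ltn_Pdiv.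
    by exists psi => // w; rewrite psiE coef_comp_poly_Xn // ek.
  exists 0 => [|w]; first exact: rpred0.
  by rewrite cfunE coef_comp_poly_Xn // (negbTE ok).
exists (psi - \sum_(j < k.+1) phi j * chi (rev_ord (widen_ord (leqnSn _) j))).
  by rewrite rpredB // rpred_sum // => j _; rewrite rpredM.
move=> w; rewrite !cfunE sum_cfunE psiE -ext_subset_poly coefM big_ord_recr /=.
rewrite subnn subset_poly0 mulr1 addrC -addrA.
under [X in _ - X]eq_bigr => j _ do rewrite cfunE phiE chiE /= subSS.
by rewrite subrr addr0.
Qed.

Variable x0 : T.

(** The quotient of ext_poly w by 1 - 'X, obtained by dividing the factor of the
    cycle of x0; it does not depend on x0.  Up to the sign (-1)^k its k-th
    coefficient is the character of the k-th exterior power of the standard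
    representation, of hook shape (n - k, 1, ..., 1). *)
Definition hook_poly w : {poly algC} :=
  (\sum_(i < #|porbit w x0|) 'X^i) *
  \prod_(C in porbits w :\ porbit w x0) (1 - 'X^#|C|).

Lemma ext_hook_poly w : ext_poly w = (1 - 'X) * hook_poly w.
Proof.
rewrite /ext_poly (big_setD1 (porbit w x0)) ?imset_f //= /hook_poly mulrA.
by congr (_ * _); rewrite -opprB subrX1 -mulNr opprB.
Qed.

Lemma hook_poly_vchar k : exists2 phi : 'CF(G), phi \in 'Z[irr G]
  & forall w, phi w = (hook_poly w)`_k.
Proof.
elim: k => [|k [phi Zphi phiE]].
  have [psi Zpsi psiE] := ext_poly_vchar 0; exists psi => // w.
  by rewrite psiE ext_hook_poly mulrBl mul1r coefB coefXM subr0.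
have [psi Zpsi psiE] := ext_poly_vchar k.+1.
exists (phi + psi) => [|w]; first by rewrite rpredD.
by rewrite cfunE phiE psiE ext_hook_poly mulrBl mul1r coefB coefXM addrC subrK.
Qed.

Lemma hook_poly_int w k : (hook_poly w)`_k \in Num.int.
Proof.
apply: (polyOverP _ k); rewrite rpredM ?rpred_sum ?rpred_prod // => [i|C] _.
  by rewrite polyOverXn.
by rewrite rpredB ?rpred1 ?polyOverXn.
Qed.

Lemma hook_poly1 k : (hook_poly 1%g)`_k = (-1) ^+ k * 'C(#|T|.-1, k)%:R.
Proof.
have P1 x : porbit (1%g : {perm T}) x = [set x] by rewrite porbit_fix ?perm1.
have -> : hook_poly 1%g = (1 - 'X) ^+ #|T|.-1.
  rewrite /hook_poly P1 cards1 big_ord1 expr0 mul1r.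
  rewrite (eq_bigr (fun _ => 1 - 'X)) => [|C /setD1P[_ /imsetP[x _ ->]]].
    rewrite prodr_const; congr (_ ^+ _).
    have -> : porbits (1%g : {perm T}) = [set [set x] | x in [set: T]].
      by apply/setP => C; apply/imsetP/imsetP => -[x _ ->]; exists x.
    have x0P : [set x0] \in [set [set x] | x in [set: T]] by apply: imset_f.
    by rewrite -cardsT -(card_imset _ (@set1_inj T)) [in RHS](cardsD1 [set x0]) x0P.
  by rewrite P1 cards1 expr1.
exact: coef_expr_1subX.
Qed.

(** As soon as there are two cycles, one of the factors 1 - 'X^#|C| remains and
    vanishes at 1. *)
Lemma hook_poly_full w : (hook_poly w).[1]
  = if porbits w == [set [set: T]] then #|T|%:R else 0.
Proof.
rewrite /hook_poly hornerM horner_sum horner_prod.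
have -> : \sum_(i < #|porbit w x0|) ('X^i).[1] = #|porbit w x0|%:R :> algC.
  rewrite (eq_bigr (fun=> 1)) => [|i _]; last by rewrite hornerXn expr1n.
  by rewrite sumr_const card_ord.
case: eqP => [wT|wT].
  have wx : porbit w x0 = [set: T].
    by apply/set1P; rewrite -wT imset_f.
  by rewrite wx cardsT wT setDv big_set0 mulr1.
case: (set_0Vmem (porbits w :\ porbit w x0)) => [w0|[C CP]].
  case: wT; have wE : porbits w = [set porbit w x0].
    apply/eqP; rewrite eqEsubset sub1set imset_f // andbT.
    by rewrite -setD_eq0 w0.
  by rewrite wE; congr [set _]; rewrite -(cover_partition (partition_porbits w)) wE cover1.
have -> : \prod_(C in porbits w :\ porbit w x0) (1 - 'X^#|C|).[1] = 0 :> algC.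
  by apply/eqP/prodf_eq0; exists C; rewrite // !hornerE expr1n subrr.
by rewrite mulr0.
Qed.

Lemma size_hook_poly w : (size (hook_poly w) <= #|T|)%N.
Proof.
have cT : #|T| = (#|porbit w x0| + \sum_(C in porbits w :\ porbit w x0) #|C|)%N.
  rewrite -cardsT (card_partition (partition_porbits w)).
  by rewrite (big_setD1 (porbit w x0)) ?imset_f.
have le_s : (size (\sum_(i < #|porbit w x0|) 'X^i : {poly algC})%R <= #|porbit w x0|)%N.
  apply: leq_trans (size_sum _ _ _) _; apply/bigmax_leqP => i _.
  by rewrite size_polyXn.
have le_p : (size (\prod_(C in porbits w :\ porbit w x0) (1 - 'X^#|C|) : {poly algC})%R
    <= (\sum_(C in porbits w :\ porbit w x0) #|C|).+1)%N.
  apply: leq_trans (size_poly_prod_leq _ _) _.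
  rewrite leq_subLR addnS ltnS -sum1_card -big_split; apply: leq_sum => C _ /=.
  apply: leq_trans (size_polyD _ _) _.
  by rewrite size_polyN size_polyXn size_poly1 geq_max leqnn.
apply: leq_trans (size_polyMleq _ _) _; rewrite cT.
by have := leq_add le_s le_p; rewrite addnS; case: (_ + _)%N.
Qed.

End Exterior.

(** * Hook characters and products of two full cycles *)

Section ExpRecExamples.
Variable R : comNzRingType.
Implicit Types (u v : R) (f g a b : nat -> R).

Lemma eq_exp_rec f g a b : f =1 g -> a =1 b -> exp_rec f a -> exp_rec g b.
Proof.
move=> fg ab [a0 aS]; split=> [|n]; first by rewrite -ab.
by rewrite -ab aS; apply: eq_bigr => k _; rewrite fg ab.
Qed.

Lemma exp_rec_geometric u : exp_rec (fun k => u ^+ k) (fun n => u ^+ n).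
Proof.
split=> [|n]; first exact: expr0.
rewrite (eq_bigr (fun=> u ^+ n)) => [|k _]; last by rewrite -exprD subnKC.
by rewrite sumr_const card_ord mulr_natl.
Qed.

(** The coefficients of 1 - u x. *)
Definition linear_seq u (n : nat) : R := (n == 0%N)%:R - u * (n == 1%N)%:R.

Lemma cauchy_prod_linear_seq u b n :
  cauchy_prod (linear_seq u) b n.+1 = b n.+1 - u * b n.
Proof.
rewrite /cauchy_prod !big_ord_recl big1 => [|i _]; rewrite /linear_seq /= ?mulr0 ?mulr1.
  by rewrite subn0 subr0 mul1r sub0r addr0 mulNr subn1.
by rewrite subr0 mul0r.
Qed.

Lemma exp_rec_linear u : exp_rec (fun k => - u ^+ k) (linear_seq u).
Proof.
split=> [|[|[|n]]]; rewrite /linear_seq ?big_ord0 ?mul0r //.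
- by rewrite /= mulr0 subr0.
- by rewrite big_ord1 /= expr1 mulr1 !mulr0 subr0 sub0r mul1r mulr1.
rewrite !big_ord_recr /= big1 => [|k _]; last first.
  have kn := ltn_ord k.
  have gt1 : (1 < n.+1 - k)%N by rewrite ltn_subRL addn1 ltnS.
  rewrite subSS (gtn_eqF gt1) (gtn_eqF (ltnW gt1)).
  by rewrite !mulr0 subr0 mulr0.
rewrite !subnn subSn ?subnn //= !(mulr0, subr0, add0r, sub0r, mulr1) exprSr.
by rewrite oppr0 mulr0 mulrN mulNr opprK -!exprSr subrr.
Qed.

(** Since (1 - u^k) (1 - v^k) = 1 + (u v)^k - u^k - v^k, the generating series is
    (1 - u x) (1 - v x) / ((1 - x) (1 - u v x)). *)
Lemma exp_rec_two_hooks u v :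
  exp_rec (fun k => (1 - u ^+ k) * (1 - v ^+ k))
    (fun n => if n is 0 then 1 else (1 - u) * (1 - v) * \sum_(i < n) (u * v) ^+ i).
Proof.
have := exp_rec_cauchy_prod (exp_rec_linear u) (exp_rec_cauchy_prod (exp_rec_linear v)
  (exp_rec_cauchy_prod (exp_rec_geometric (u * v)) (exp_rec_geometric 1))).
apply: eq_exp_rec => [k|n]; first by rewrite expr1n exprMn; ring.
pose s n := \sum_(i < n.+1) (u * v) ^+ i.
have cs m : cauchy_prod (fun n => (u * v) ^+ n) (fun n => 1 ^+ n) m = s m.
  by apply: eq_bigr => i _; rewrite expr1n mulr1.
case: n => [|[|n]].
- by rewrite /cauchy_prod !big_ord1 /linear_seq /= !mulr0 !subr0 !expr0 !mulr1.
- rewrite !cauchy_prod_linear_seq /cauchy_prod !big_ord_recl !big_ord0 /linear_seq /=. 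
  rewrite !(mulr0, subr0, expr0, expr1, mulr1, addr0, sub0r). ring.
rewrite !cauchy_prod_linear_seq !cs -/(s n.+1).
have s1 m : s m.+1 = 1 + (u * v) * s m.
  rewrite /s big_ord_recl mulr_sumr; congr (_ + _); apply: eq_bigr => i _.
  by rewrite -exprS.
have s2 : s n.+2 = s n.+1 + (u * v) ^+ n.+2 by rewrite /s big_ord_recr.
rewrite (s1 n.+1) (s1 n). ring.
Qed.

End ExpRecExamples.

Section HookCharacters.
Local Open Scope group_scope.
Local Open Scope ring_scope.
Variables (T : finType) (x0 : T).
Implicit Types (w x y : {perm T}).
Let G := [set: {perm T}]%G.
Let n := #|T|.

Let n_gt0 : (0 < n)%N. Proof. by apply/card_gt0P; exists x0. Qed.

(** The exponential formula over the polynomials in two variables u and v sums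
    the products of ext_poly w at u and ext_poly w at v; the factor
    (1 - u) (1 - v) cancels. *)
Lemma hook_poly_orthonormal i j : (i < n)%N -> (j < n)%N ->
  \sum_w (hook_poly x0 w)`_i * (hook_poly x0 w)`_j = n`!%:R * (i == j)%:R.
Proof.
move=> i_n j_n.
(* The outer and the inner variable. *)
pose u : {poly {poly algC}} := 'X; pose v : {poly {poly algC}} := 'X%:P.
have E : \sum_w map_poly polyC (hook_poly x0 w) * (hook_poly x0 w)%:P
    = n`!%:R * \sum_(k < n) (u * v) ^+ k.
  have u1 : 1 - u != 0.
    by rewrite -opprB oppr_eq0 polyXsubC_eq0.
  have v1 : 1 - v != 0.
    by rewrite -[1]/(1%:P) -polyCB polyC_eq0 -opprB oppr_eq0 polyXsubC_eq0.
  apply: (mulfI (mulf_neq0 u1 v1)); rewrite mulr_sumr.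
  rewrite [RHS]mulrCA; have := sum_porbits T (exp_rec_two_hooks u v).
  rewrite -/n -(prednK n_gt0) /= => <-.
  apply: eq_bigr => w _; rewrite big_split /= mulrACA; congr (_ * _).
    rewrite -[1 - u](_ : map_poly polyC (1 - 'X) = _); last first.
      by rewrite rmorphB /= rmorph1 map_polyX.
    rewrite -rmorphM -ext_hook_poly rmorph_prod; apply: eq_bigr => C _ /=.
    by rewrite rmorphB /= rmorph1 map_polyXn.
  rewrite -[1 - v](_ : (1 - 'X)%:P = _); last by rewrite polyCB.
  rewrite -polyCM -ext_hook_poly rmorph_prod; apply: eq_bigr => C _ /=.
  by rewrite polyCB rmorphXn.
have /(congr1 (fun p : {poly {poly algC}} => p`_i`_j)) := E.
rewrite !coef_sum (eq_bigr (fun w => (hook_poly x0 w)`_i * (hook_poly x0 w)`_j)); last first.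
  by move=> w _; rewrite coefMC coef_map /= coefCM.
move=> ->; rewrite -!polyC_natr coefCM coefCM coef_sum; congr (_ * _).
rewrite (bigD1 (Ordinal i_n)) //= big1 ?addr0 => [|k ki].
  by rewrite exprMn -rmorphXn coefMC coefXn eqxx mul1r coefXn eq_sym.
rewrite exprMn -rmorphXn coefMC coefXn (_ : (i == k)%N = false) ?mul0r ?coef0 //.
by apply: contraNF ki => /eqP ik; apply/eqP/val_inj.
Qed.

Lemma card_perm_group : #|G| = n`!.
Proof.
rewrite /n -cardsT -card_perm; apply: eq_card => w; rewrite inE.
by symmetry; apply/subsetP => z _; rewrite inE.
Qed.

(** A virtual character of norm 1 is irreducible up to sign. *)
Lemma hook_poly_irr i : (i < n)%N ->
  exists b : bool, exists k : Iirr G, forall w, (hook_poly x0 w)`_i = (-1) ^+ b * 'chi_k w.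
Proof.
move=> i_n; have [phi Zphi phiE] := hook_poly_vchar x0 i.
have /(vchar_norm1P Zphi)[b [k phik]] : '[phi] = 1.
  rewrite cfdotE card_perm_group (eq_bigl xpredT) => [|w]; last by rewrite inE.
  rewrite (eq_bigr (fun w => (hook_poly x0 w)`_i * (hook_poly x0 w)`_i)).
    by rewrite hook_poly_orthonormal // eqxx mulr1 mulVf // pnatr_eq0 -lt0n fact_gt0.
  by move=> w _; rewrite phiE conj_intr ?hook_poly_int.
by exists b, k => w; rewrite -phiE phik cfunE.
Qed.

(** Irreducible characters are, up to #|G| / chi(1), orthogonal idempotents for
    convolution.  The unknown signs of hook_poly_irr cancel, because the value at
    1%g carries the same sign. *)
Lemma hook_poly_convolution i j y : (i < n)%N -> (j < n)%N ->
  \sum_x (hook_poly x0 (x * y)%g)`_i * (hook_poly x0 x^-1%g)`_j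
  = (i == j)%:R * (n`!%:R * (-1) ^+ i / 'C(n.-1, i)%:R * (hook_poly x0 y)`_i).
Proof.
move=> i_n j_n.
have [b [k iE]] := hook_poly_irr i_n; have [c [l jE]] := hook_poly_irr j_n.
have nf0 : n`!%:R != 0 :> algC by rewrite pnatr_eq0 -lt0n fact_gt0.
have orth z : \sum_x 'chi_k (x * z)%g * 'chi_l x^-1%g
    = n`!%:R * ((k == l)%:R * ('chi_k z / 'chi_k 1%g)).
  rewrite -generalized_orthogonality_relation card_perm_group mulrA mulfV // mul1r.
  by apply: eq_bigl => w; rewrite inE.
have -> : \sum_x (hook_poly x0 (x * y)%g)`_i * (hook_poly x0 x^-1%g)`_j
   = (-1) ^+ b * (-1) ^+ c * \sum_x 'chi_k (x * y)%g * 'chi_l x^-1%g.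
  by rewrite mulr_sumr; apply: eq_bigr => x _; rewrite iE jE mulrACA.
rewrite orth.
have skl : (-1) ^+ b * (-1) ^+ c * (k == l)%:R = (i == j)%:R :> algC.
  apply: (mulfI nf0); rewrite -(hook_poly_orthonormal i_n j_n).
  rewrite mulrCA -cfdot_irr cfdotE card_perm_group mulVKf // mulr_sumr.
  apply: eq_big => [w|w _]; first by rewrite inE.
  rewrite -[X in _ = _ * X](conj_intr (hook_poly_int x0 w j)) iE jE rmorphM rmorph_sign.
  by rewrite mulrACA.
have -> : 'chi_k y / 'chi_k 1%g = (hook_poly x0 y)`_i / (hook_poly x0 1%g)`_i.
  by rewrite !iE -mulf_div mulfV ?signr_eq0 // mul1r.
by rewrite hook_poly1 -/n invfM invr_sign -skl; ring.
Qed.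

Definition one_cycle (s : {perm T}) := porbits s == [set [set: T]].

(** The right-hand side is hook_poly evaluated at 1, divided by n. *)
Lemma one_cycleE s :
  (one_cycle s)%:R = n%:R^-1 * \sum_(i < n) (hook_poly x0 s)`_i :> algC.
Proof.
have nn0 : n%:R != 0 :> algC by rewrite pnatr_eq0 -lt0n.
apply: (mulfI nn0); rewrite mulVKf //.
have := hook_poly_full x0 s; rewrite -/(one_cycle s) (horner_coef_wide _ (size_hook_poly x0 s)).
rewrite -/n (eq_bigr (fun i : 'I_n => (hook_poly x0 s)`_i)) => [->|i _].
  by case: (one_cycle s); rewrite ?mulr1 ?mulr0.
by rewrite expr1n mulr1.
Qed.

(** By one_cycleE, the indicator of the full cycles is a combination of hook
    characters, for which convolution is diagonal; it remains to sum its
    convolution square over P. *)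
Lemma card_one_cycle_product (P : pred {perm T}) :
  #|[set ab : {perm T} * {perm T} | [&& one_cycle ab.1, one_cycle ab.2 & P (ab.1 * ab.2)%g]]|%:R
  = n`!%:R / n%:R ^+ 2 *
    \sum_(i < n) (-1) ^+ i / 'C(n.-1, i)%:R * (\sum_(y | P y) (hook_poly x0 y))`_i.
Proof.
transitivity (\sum_(y | P y) \sum_x (one_cycle (x * y)%g)%:R * (one_cycle x^-1%g)%:R : algC).
  rewrite pair_big /= -sum1_card natr_sum.
  rewrite (reindex (fun p : {perm T} * {perm T} => (p.2^-1, p.2 * p.1)%g)) /=; last first.
    exists (fun ab => (ab.1 * ab.2, ab.1^-1)%g) => -[a b] _ /=.
      by rewrite mulKg invgK.
    by rewrite invgK mulKg.
  rewrite big_mkcond [RHS]big_mkcond; apply: eq_bigr => -[y x] _ /=.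
  rewrite inE /= mulKg -natrM mulnb.
  by case: (P y); case: (one_cycle x^-1%g); case: (one_cycle (x * y)%g).
transitivity (\sum_(y | P y) n`!%:R / n%:R ^+ 2 *
    \sum_(i < n) (-1) ^+ i / 'C(n.-1, i)%:R * (hook_poly x0 y)`_i); last first.
  rewrite -mulr_sumr exchange_big; congr (_ * _); apply: eq_bigr => i _ /=.
  by rewrite coef_sum mulr_sumr.
apply: eq_bigr => y _.
under eq_bigr => x _ do rewrite !one_cycleE mulrACA -invfM -expr2 mulr_suml.
rewrite -mulr_sumr exchange_big /=.
rewrite [n`!%:R / _]mulrC -[RHS]mulrA; congr (_ * _).
rewrite [RHS]mulr_sumr.
apply: eq_bigr => i _.
under eq_bigr => x _ do rewrite mulr_sumr.
rewrite exchange_big /= (bigD1 i) //= hook_poly_convolution // eqxx big1 => [|j ji].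
  by rewrite addr0 mul1r -!mulrA.
rewrite hook_poly_convolution // (_ : (i == j :> nat) = false) ?mul0r //.
by apply: contraNF ji => /eqP ij; apply/eqP/val_inj.
Qed.
End HookCharacters.

(** * Square roots and inverse binomial coefficients *)

Section ExpRecTransforms.
Variables (R : comNzRingType).
Implicit Types (f a : nat -> R).

Lemma exp_rec_rmorph (S : comNzRingType) (h : {rmorphism R -> S}) f a :
  exp_rec f a -> exp_rec (h \o f) (h \o a).
Proof.
move=> [a0 aS]; split=> [|n] /=; first by rewrite a0 rmorph1.
by rewrite -(rmorph_nat h) -rmorphM aS rmorph_sum; apply: eq_bigr => k _; rewrite rmorphM.
Qed.

Lemma exp_rec_dilate v f a :
  exp_rec f a -> exp_rec (fun k => f k * v ^+ k) (fun n => a n * v ^+ n).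
Proof.
move=> [a0 aS]; split=> [|n] /=; first by rewrite a0 mulr1.
rewrite mulrA aS mulr_suml; apply: eq_bigr => k _.
by rewrite mulrACA -exprD subnKC.
Qed.

Lemma sum_ord_double (h : nat -> R) l :
  \sum_(k < l.*2) h k = \sum_(j < l) (h j.*2 + h j.*2.+1).
Proof.
elim: l => [|l IH]; first by rewrite !big_ord0.
by rewrite doubleS !big_ord_recr /= IH addrA.
Qed.

(** The substitution of x^2 for x in exp (\sum_k f k x^k / k), where f k x^(2k) / k
    is rewritten as (2 f k) x^(2k) / (2k). *)
Lemma exp_rec_double f a : exp_rec f a ->
  exp_rec (fun k => if odd k then 0 else 2 * f k./2)
          (fun n => if odd n then 0 else a n./2).
Proof.
move=> [a0 aS]; split=> // n.
case: ifP => on.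
  rewrite mulr0 big1 // => k _; case: ifPn => ok; rewrite ?mul0r //.
  by rewrite oddB ?on ?(negbTE ok) //= mulr0.
rewrite -[n]odd_double_half on add0n; move: n./2 => l {on}.
rewrite (sum_ord_double (fun k => (if odd k.+1 then 0 else 2 * f k.+1./2) *
  (if odd (l.*2 - k.+1) then 0 else a (l.*2 - k.+1)./2))) doubleK -[in LHS]mul2n natrM -mulrA aS mulr_sumr.
apply: eq_bigr => j _ /=.
rewrite odd_double /= mul0r add0r.
by rewrite -doubleS -doubleB odd_double !doubleK mulrA.
Qed.
End ExpRecTransforms.

Section CentralBinomials.
Variable F : numFieldType.

(** The coefficient of x^l in (1 - x)^(-1/2). *)
Definition invsqrt_coef l : F := 'C(2 * l, l)%:R / 4 ^+ l.
(** The coefficient of x^l in (1 - x)^(1/2). *)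
Definition sqrt_coef l : F := - invsqrt_coef l / (2 * l%:R - 1).

Lemma central_binS l : (l.+1 * 'C(2 * l.+1, l.+1) = 2 * (2 * l).+1 * 'C(2 * l, l))%N.
Proof.
have sym : 'C((2 * l).+1, l) = 'C((2 * l).+1, l.+1).
  by rewrite -[in RHS]bin_sub; [congr 'C(_, _); lia | lia].
rewrite (_ : 2 * l.+1 = (2 * l).+2)%N; last by lia.
by rewrite binS sym addnn -mul2n mulnCA -mul_bin_diag mulnA.
Qed.

Lemma invsqrt_coefS l : invsqrt_coef l.+1 * (2 * l.+1%:R) = (2 * l%:R + 1) * invsqrt_coef l.
Proof.
have := congr1 (fun n => n%:R : F) (central_binS l).
rewrite !natrM -[(2 * l).+1]addn1 natrD natrM => H.
rewrite /invsqrt_coef exprS invfM.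
transitivity (l.+1%:R * 'C(2 * l.+1, l.+1)%:R * 2 / 4 / 4 ^+ l : F); first by ring.
rewrite H. have -> : 4 = 2 * 2 :> F by ring. field.
by rewrite expf_neq0 ?mulf_neq0 ?pnatr_eq0.
Qed.

(** Both sides are the coefficient of x^(n-1) in (1 - x)^(-3/2), the right-hand
    side by differentiation. *)
Lemma sum_invsqrt_coef n : \sum_(j < n) invsqrt_coef j = 2 * n%:R * invsqrt_coef n.
Proof.
elim: n => [|n IH]; first by rewrite big_ord0 mulr0 mul0r.
rewrite big_ord_recr IH /= -[RHS]mulrC invsqrt_coefS; ring.
Qed.

Lemma double_sub1_neq0 n : 2 * n%:R - 1 != 0 :> F.
Proof.
rewrite -natrM subr_eq0 -[1]/(1%:R) eqr_nat; apply/eqP => /(congr1 odd).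
by rewrite oddM.
Qed.

(** This is (1 - x)^(1/2) / (1 - x) = (1 - x)^(-1/2). *)
Lemma sum_sqrt_coef n : \sum_(j < n.+1) sqrt_coef j = invsqrt_coef n.
Proof.
elim: n => [|n IH].
  by rewrite big_ord1 /sqrt_coef /invsqrt_coef /= mulr0 sub0r bin0 expr0 divr1 invrN invr1 mulrNN mulr1.
rewrite big_ord_recr IH /= /sqrt_coef.
have H := invsqrt_coefS n; have n0 := double_sub1_neq0 n.+1.
apply: (mulIf n0); rewrite mulrDl divfK //.
transitivity ((2 * n%:R + 1) * invsqrt_coef n - invsqrt_coef n.+1); first by rewrite -natr1; ring.
by rewrite -H -natr1; ring.
Qed.

Lemma exp_rec_invsqrt : exp_rec (fun=> 2^-1) invsqrt_coef.
Proof.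
split=> [|n]; first by rewrite /invsqrt_coef bin0 expr0 divr1.
rewrite -mulr_sumr (reindex_inj rev_ord_inj) /=.
rewrite (eq_bigr (fun j : 'I_n => invsqrt_coef j)) => [|j _]; last by rewrite /= subnSK // subKn // ltnW.
by rewrite sum_invsqrt_coef -mulrA mulKf ?pnatr_eq0.
Qed.

Lemma exp_rec_sqrt : exp_rec (fun=> - 2^-1) sqrt_coef.
Proof.
split=> [|n]; first by move: (sum_sqrt_coef 0); rewrite big_ord1 => ->; rewrite /invsqrt_coef bin0 expr0 divr1.
rewrite -mulr_sumr (reindex_inj rev_ord_inj) /=.
rewrite (eq_bigr (fun j : 'I_n => sqrt_coef j)) => [|j _]; last by rewrite /= subnSK // subKn // ltnW.
case: n => [|n]; first by rewrite big_ord0 mulr0 mul0r.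
have n0 := double_sub1_neq0 n.+1; rewrite sum_sqrt_coef /sqrt_coef.
have -> : invsqrt_coef n = invsqrt_coef n.+1 * (2 * n.+1%:R) / (2 * n.+1%:R - 1).
  rewrite invsqrt_coefS (_ : 2 * n%:R + 1 = 2 * n.+1%:R - 1) 1?[RHS]mulrAC ?mulfV ?mul1r //.
  by rewrite -natr1; ring.
move: (n.+1%:R) n0 => t t0; field; exact: t0.
Qed.

(** The sum telescopes: 1 / 'C(n, j) is (n + 1) / (n + 2) times the sum of
    1 / 'C(n + 1, j) and 1 / 'C(n + 1, j + 1). *)
Lemma sum_inv_bin n j : (j <= n.+1)%N ->
  \sum_(i < j) (-1) ^+ i / 'C(n, i)%:R
  = n.+1%:R / n.+2%:R * (1 - (-1) ^+ j / 'C(n.+1, j)%:R) :> F.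
Proof.
elim: j => [|j IH] jn; first by rewrite big_ord0 bin0 expr0 divr1 subrr mulr0.
rewrite big_ord_recr IH 1?ltnW //=.
have E1 : 'C(n.+1, j)%:R * (n.+1 - j)%:R = n.+1%:R * 'C(n, j)%:R :> F.
  by rewrite -!natrM mulnC -mul_bin_down.
have E2 : j.+1%:R * 'C(n.+1, j.+1)%:R = n.+1%:R * 'C(n, j)%:R :> F.
  by rewrite -!natrM -mul_bin_diag.
have N0 k : k.+1%:R != 0 :> F by rewrite pnatr_eq0.
have B0 m k : (k <= m)%N -> 'C(m, k)%:R != 0 :> F.
  by move=> km; rewrite pnatr_eq0 -lt0n bin_gt0.
have nj0 : (n.+1 - j)%:R != 0 :> F by rewrite pnatr_eq0 -lt0n subn_gt0.
have -> : 'C(n.+1, j)%:R = n.+1%:R * 'C(n, j)%:R / (n.+1 - j)%:R :> F.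
  by rewrite -E1 mulfK.
have -> : 'C(n.+1, j.+1)%:R = n.+1%:R * 'C(n, j)%:R / j.+1%:R :> F.
  by rewrite -E2 mulrC mulKf.
have jn' : (j <= n)%N by [].
have Ej : n.+2%:R = (n.+1 - j)%:R + j.+1%:R :> F.
  by rewrite -natrD addnS subnK 1?ltnW.
rewrite exprS !invfM !invrK; move: (B0 _ _ jn') (N0 n.+1); rewrite Ej.
move: (n.+1 - j)%:R (j.+1%:R) (n.+1%:R) nj0 (N0 j) (N0 n) => p r t p0 r0 t0 b0 s0.
by field; rewrite b0 s0 t0.
Qed.

End CentralBinomials.

(** * Products of two full cycles with even cycles only *)

Lemma coef_sum_Xn (R : comNzRingType) n i :
  (\sum_(j < n) 'X^j : {poly R})`_i = (i < n)%N%:R.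
Proof.
have -> : \sum_(j < n) 'X^j = \poly_(j < n) 1 :> {poly R}.
  by rewrite poly_def; apply: eq_bigr => j _; rewrite scale1r.
by rewrite coef_poly; case: ltnP.
Qed.

Section EvenCycles.
Local Open Scope group_scope.
Local Open Scope ring_scope.
Variables (T : finType) (x0 : T) (m : nat).
Hypothesis cardT : #|T| = m.*2.
Implicit Types (w : {perm T}).

Definition all_even w := [forall C in porbits w, ~~ odd #|C|].

Let c := @invsqrt_coef algC.
Let d := @sqrt_coef algC.

(** The exponential formula for the weight 1 - 'X^k on the even k, and 0 on the
    odd k, with generating series (1 - 'X^2 x^2)^(1/2) (1 - x^2)^(-1/2). *)
Lemma sum_even_ext_poly :
  \sum_(w | all_even w) ext_poly w
  = (m.*2)`!%:R * \sum_(k < m.+1) (d k * c (m - k))%:P * 'X^(k.*2).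
Proof.
have rec : exp_rec (fun k => if odd k then 0 else (1 - 'X^k : {poly algC}))
    (fun n => if odd n then 0
              else cauchy_prod (fun k => (d k)%:P * 'X^2 ^+ k) (fun k => (c k)%:P) n./2).
  have := exp_rec_double (exp_rec_cauchy_prod
    (exp_rec_dilate 'X^2 (exp_rec_rmorph polyC (exp_rec_sqrt algC)))
    (exp_rec_rmorph polyC (exp_rec_invsqrt algC))).
  apply: eq_exp_rec => // k; case: ifPn => // ek.
  rewrite /= -[in RHS](even_halfK ek) -mul2n exprM mulrDr mulrA.
  rewrite -!polyC_natr -!polyCM mulrN mulfV ?pnatr_eq0 // addrC.
  by rewrite polyCN polyC1 mulN1r.
have := sum_porbits T rec; rewrite cardT odd_double doubleK => E.
rewrite big_mkcond /= (eq_bigr (fun w : {perm T} => \prod_(C in porbits w)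
    (if odd #|C| then 0 else 1 - 'X^#|C|))); last first.
  move=> w _; case: ifPn => [/forall_inP ev|].
    by apply: eq_bigr => C /ev /negbTE ->.
  rewrite negb_forall_in => /exists_inP[C Cw]; rewrite negbK => oC.
  by rewrite (bigD1 C) //= oC mul0r.
rewrite E; congr (_ * _); apply: eq_bigr => k _.
by rewrite [in RHS]polyCM [RHS]mulrAC -mul2n exprM.
Qed.

(** The coefficients of the right-hand side of sum_even_ext_poly add up to 0, by
    (1 - x)^(1/2) (1 - x)^(-1/2) = 1, so 'X^(k.*2) can be replaced by 'X^(k.*2) - 1,
    which is divisible by 'X - 1. *)
Lemma sum_even_hook_poly : (0 < m)%N ->
  \sum_(w | all_even w) hook_poly x0 w
  = (m.*2)`!%:R * - \sum_(k < m.+1) (d k * c (m - k))%:P * \sum_(i < k.*2) 'X^i.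
Proof.
move=> m_gt0; have X1 : 1 - 'X != 0 :> {poly algC}.
  by rewrite -opprB oppr_eq0 polyXsubC_eq0.
apply: (mulfI X1); rewrite mulr_sumr (eq_bigr (@ext_poly T)) => [|w _]; last first.
  by rewrite (ext_hook_poly x0).
rewrite sum_even_ext_poly [RHS]mulrCA; congr (_ * _).
have dc0 : \sum_(k < m.+1) d k * c (m - k)%N = 0.
  have [_ /(_ m)] := exp_rec_cauchy_prod (exp_rec_sqrt algC) (exp_rec_invsqrt algC).
  rewrite [RHS]big1 => [/eqP|k _]; last by rewrite addNr mul0r.
  by rewrite mulf_eq0 pnatr_eq0 eqn0Ngt m_gt0 => /eqP.
transitivity (\sum_(k < m.+1) (d k * c (m - k)%N)%:P * ('X^(k.*2) - 1)).
  under [RHS]eq_bigr => k _ do rewrite mulrBr mulr1.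
  by rewrite sumrB -rmorph_sum dc0 rmorph0 subr0.
rewrite mulrN -mulNr opprB mulr_sumr; apply: eq_bigr => k _.
by rewrite subrX1 mulrCA.
Qed.

(** The hook of index 0 is the trivial character: orthogonality to it leaves one
    term of one_cycleE. *)
Lemma sum_one_cycle : \sum_(s : {perm T}) (one_cycle s)%:R = (#|T|.-1)`!%:R :> algC.
Proof.
have n_gt0 : (0 < #|T|)%N by apply/card_gt0P; exists x0.
have hook0 s : (hook_poly x0 s)`_0 = 1.
  by have := ext_poly0 s; rewrite (ext_hook_poly x0) mulrBl mul1r coefB coefXM subr0.
under eq_bigr => s _ do rewrite (one_cycleE x0).
rewrite -mulr_sumr exchange_big /=.
transitivity (#|T|%:R^-1 * \sum_(i < #|T|) #|T|`!%:R * ((i : nat) == 0%N)%:R : algC).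
  congr (_ * _); apply: eq_bigr => i _.
  rewrite -(hook_poly_orthonormal x0 (ltn_ord i) n_gt0).
  by apply: eq_bigr => s _; rewrite hook0 mulr1.
rewrite (bigD1 (Ordinal n_gt0)) //= mulr1 big1 ?addr0 => [|i i0]; last first.
  by rewrite (_ : (i == 0 :> nat) = false) ?mulr0 //; apply: contraNF i0 => /eqP i0; apply/eqP/val_inj.
rewrite -[in X in X`!](prednK n_gt0) factS (prednK n_gt0) natrM mulKf //.
by rewrite pnatr_eq0 -lt0n.
Qed.

Lemma even_product_count : (0 < m)%N ->
  #|[set ab : {perm T} * {perm T} |
      [&& one_cycle ab.1, one_cycle ab.2 & all_even (ab.1 * ab.2)%g]]|%:R
  = ((m.*2).-1)`!%:R ^+ 2 * (m.*2%:R / (m.*2).+1%:R *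
    \sum_(k < m.+1) - d k * c (m - k)%N * (1 - 'C(m.*2, k.*2)%:R^-1)) :> algC.
Proof.
move=> m_gt0; rewrite (card_one_cycle_product x0) cardT sum_even_hook_poly //.
have [n nE] : exists n, m.*2 = n.+1 by exists (m.*2).-1; rewrite prednK // double_gt0.
transitivity ((m.*2)`!%:R / m.*2%:R ^+ 2 * ((m.*2)`!%:R *
  \sum_(k < m.+1) - d k * c (m - k)%N *
     \sum_(i < k.*2) (-1) ^+ i / 'C((m.*2).-1, i)%:R : algC)).
  congr (_ * _).
  transitivity (\sum_(i < m.*2) \sum_(k < m.+1) (m.*2)`!%:R * (- d k * c (m - k)%N *
     ((-1) ^+ i / 'C((m.*2).-1, i)%:R * (i < k.*2)%:R)) : algC).
    apply: eq_bigr => i _; rewrite -polyC_natr coefCM coefN coef_sum mulrCA -sumrN.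
    rewrite -mulr_sumr; congr (_ * _); rewrite mulr_sumr; apply: eq_bigr => k _.
    by rewrite coefCM coef_sum_Xn; ring.
  rewrite exchange_big mulr_sumr; apply: eq_bigr => k _ /=.
  rewrite -!mulr_sumr; congr (_ * (_ * _)).
  have km : (k.*2 <= m.*2)%N by rewrite leq_double -ltnS.
  rewrite (big_ord_widen m.*2 (fun i => (-1) ^+ i / 'C((m.*2).-1, i)%:R) km) [RHS]big_mkcond.
  by apply: eq_bigr => i _; case: ifP; rewrite ?mulr1 ?mulr0.
have -> : \sum_(k < m.+1) - d k * c (m - k)%N *
     \sum_(i < k.*2) (-1) ^+ i / 'C((m.*2).-1, i)%:R
   = m.*2%:R / (m.*2).+1%:R *
     \sum_(k < m.+1) - d k * c (m - k)%N * (1 - 'C(m.*2, k.*2)%:R^-1).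
  rewrite mulr_sumr; apply: eq_bigr => k _.
  have km : (k.*2 <= m.*2)%N by rewrite leq_double -ltnS.
  move: km; rewrite nE => km; rewrite sum_inv_bin //.
  by rewrite -signr_odd odd_double expr0 mul1r mulrCA.
rewrite nE factS natrM /=; set S := \sum_(k < _) _.
have n0 : n.+1%:R != 0 :> algC by rewrite pnatr_eq0.
have n1 : n.+2%:R != 0 :> algC by rewrite pnatr_eq0.
move: (n.+1%:R) (n.+2%:R) n0 n1 => t r t0 r0; field.
by rewrite t0 r0.
Qed.

End EvenCycles.

Lemma cycle_lengths_even M (s : 'S_M) : cycle_lengths_in even_pos s = all_even s.
Proof.
apply: eq_forallb => C; apply: implyb_id2l => /imsetP[x _ ->].
by rewrite inE lt0n card_porbit_neq0.
Qed.

Lemma card_full_cycles M : #|full_cycles M.+1| = M`!.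
Proof.
have := sum_one_cycle (ord0 : 'I_M.+1); rewrite card_ord /= => E.
apply/eqP; rewrite -(eqr_nat algC) -E.
by rewrite -sum1_card natr_sum big_mkcond; apply/eqP/eq_bigr => s _; rewrite inE /one_cycle; case: ifP.
Qed.

Definition q_formula (F : numFieldType) (M : nat) : F :=
  2 * M%:R / (M.+1%:R * 2 ^+ M) *
          \sum_(k < M.+1) \sum_(l < M.+1 | (k + l == M./2)%N && (1 <= k)%N)
             k%:R^-1 * 'C(2 * (k - 1), k - 1)%:R * 'C(2 * l, l)%:R *
             (1 - 'C(M, 2 * l)%:R^-1).

Lemma sqrt_coefN_S (F : numFieldType) k :
  - sqrt_coef F k.+1 = 2 / k.+1%:R * 'C(2 * k, k)%:R / 4 ^+ k.+1.
Proof.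
have n0 := double_sub1_neq0 F k.+1; have H := invsqrt_coefS F k.
have k0 : k.+1%:R != 0 :> F by rewrite pnatr_eq0.
rewrite /sqrt_coef mulNr opprK.
have E : 2 * k%:R + 1 = 2 * k.+1%:R - 1 :> F by rewrite -natr1; ring.
have -> : invsqrt_coef F k.+1 = (2 * k.+1%:R - 1) * invsqrt_coef F k / (2 * k.+1%:R).
  by rewrite -E -H mulfK // mulf_neq0 // pnatr_eq0.
rewrite /invsqrt_coef exprS; have p0 : 4 ^+ k != 0 :> F by rewrite expf_neq0 ?pnatr_eq0.
by move: (k.+1%:R) (4 ^+ k) n0 k0 p0 => t p n0 t0 p0; field; rewrite t0 n0 p0.
Qed.

Lemma q_formulaE (F : numFieldType) m : (0 < m)%N ->
  q_formula F m.*2 = m.*2%:R / (m.*2).+1%:R *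
    \sum_(k < m.+1) - sqrt_coef F k * invsqrt_coef F (m - k)%N * (1 - 'C(m.*2, k.*2)%:R^-1).
Proof.
move=> m_gt0; rewrite /q_formula doubleK.
pose h k : F := (2 * 4 ^- m) * (k%:R^-1 * 'C(2 * (k - 1), k - 1)%:R * 'C(2 * (m - k), m - k)%:R *
             (1 - 'C(m.*2, 2 * (m - k))%:R^-1)).
transitivity (m.*2%:R / (m.*2).+1%:R *
    \sum_(k < (m.*2).+1 | (0 < k)%N && (k < m.+1)%N) h k).
  have -> : 2 * m.*2%:R / ((m.*2).+1%:R * 2 ^+ m.*2)
      = m.*2%:R / (m.*2).+1%:R * (2 / 4 ^+ m) :> F.
    rewrite -mul2n exprM (_ : 2 ^+ 2 = 4); last by rewrite expr2 -natrM.
    by rewrite invfM; ring.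
  rewrite -mulrA; congr (_ * _); rewrite mulr_sumr [RHS]big_mkcond.
  apply: eq_bigr => k _; case: ifP => [/andP[k_gt0]|].
    rewrite ltnS => km; have lM : (m - k < (m.*2).+1)%N by lia.
    rewrite (big_pred1 (Ordinal lM)) // => l.
    rewrite k_gt0 andbT; apply/eqP/eqP => [kl|->]; last by rewrite /= subnKC.
    by apply: val_inj => /=; lia.
  move=> /negbT k_out; rewrite big_pred0 ?mulr0 // => l; apply/negbTE.
  by apply: contra k_out => /andP[/eqP kl ->]; rewrite ltnS; lia.
congr (_ * _); rewrite -(big_ord_widen_cond (m.*2).+1 (fun k => 0 < k)%N h); last first.
  by rewrite ltnS -addnn leq_addr.
rewrite big_mkcond; apply: eq_bigr => -[[|k] /= km] _.
  by rewrite bin0 invr1 subrr mulr0.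
rewrite sqrt_coefN_S /h /invsqrt_coef subn1 /=.
have -> : 'C(m.*2, 2 * (m - k.+1)) = 'C(m.*2, k.*2.+2).
  by rewrite -[in RHS]bin_sub; [congr 'C(_, _); lia | lia].
have -> : 4 ^+ m = 4 ^+ k.+1 * 4 ^+ (m - k.+1) :> F by rewrite -exprD subnKC.
by rewrite invfM; ring.
Qed.

Lemma q_even_algC m : (0 < m)%N -> q algC m.*2 even_pos = q_formula algC m.*2.
Proof.
move=> m_gt0; rewrite q_formulaE //.
have M_gt0 : (0 < m.*2)%N by rewrite double_gt0.
have := even_product_count (Ordinal M_gt0) (card_ord _) m_gt0.
rewrite /q cardsX -(prednK M_gt0) card_full_cycles natrM => E.
set N := #|_|%:R in E; set N' := #|_|%:R.
have -> : N' = N.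
  congr _%:R; apply: eq_card => -[a b].
  by rewrite !inE /= cycle_lengths_even /one_cycle andbA.
by rewrite E -expr2 mulrC mulKf // expf_neq0 // pnatr_eq0 -lt0n fact_gt0.
Qed.

Lemma ratr_q (F : numFieldType) M A : ratr (q rat M A) = q F M A.
Proof. by rewrite /q fmorph_div /= !ratr_nat. Qed.

Lemma ratr_q_formula (F : numFieldType) M : ratr (q_formula rat M) = q_formula F M.
Proof.
rewrite /q_formula rmorphM /= fmorph_div !rmorphM rmorphXn /= !ratr_nat rmorph_sum /=.
congr (_ * _); apply: eq_bigr => k _; rewrite rmorph_sum /=; apply: eq_bigr => l _ /=.
by rewrite !rmorphM rmorphB rmorph1 /= !fmorphV /= !ratr_nat.
Qed.

(** Both sides are rational numbers, so the identity over algC, the field of the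
    characters, holds over any F. *)
Theorem q_even (F : numFieldType) m : (0 < m)%N -> q F m.*2 even_pos = q_formula F m.*2.
Proof.
move=> m_gt0; rewrite -ratr_q -ratr_q_formula; congr (ratr _).
by apply: (fmorph_inj (@ratr algC)); rewrite /= ratr_q ratr_q_formula q_even_algC.
Qed.

(** * Block transpositions and odd cycles *)

Section OddCycles.
Local Open Scope nat_scope.
Local Open Scope group_scope.
Variable T : finType.
Implicit Types (s t g : {perm T}) (X : {set T}).

Definition odd_cycles s := [set C in porbits s | odd #|C|].

(** The lengths of all the cycles add up to #|T|. *)
Lemma odd_card_odd_cycles s : odd #|odd_cycles s| = odd #|T|.
Proof.
have -> : #|odd_cycles s| = (\sum_(C in porbits s) odd #|C|)%N.
  rewrite -sum1_card big_mkcond [RHS]big_mkcond; apply: eq_bigr => C _.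
  by rewrite inE; case: (C \in _); case: (odd _).
rewrite -cardsT (card_partition (partition_porbits s)).
by elim/big_rec2: _ => // C k l _ E; rewrite !oddD E oddb.
Qed.

Lemma odd_cycles_local s t X : {in ~: X, s =1 t} ->
  [set C in odd_cycles s | [disjoint C & X]] = [set C in odd_cycles t | [disjoint C & X]].
Proof.
have H s' t' : {in ~: X, s' =1 t'} ->
  [set C in odd_cycles s' | [disjoint C & X]] \subset [set C in odd_cycles t' | [disjoint C & X]].
  move=> st; apply/subsetP => C; rewrite !inE -!andbA => /and3P[/imsetP[c _ CE] oC CX].
  rewrite oC CX !andbT; apply/imsetP; exists c => //.
  rewrite CE; apply: (@eq_in_porbit _ s' t' (porbit s' c)); last exact: porbit_id.
    by move=> z; apply: mem_porbit_succ.
  by move=> z zc; apply: st; rewrite inE (disjointFr CX) // CE.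
move=> st; apply/eqP; rewrite eqEsubset !H // => z zX; by rewrite st.
Qed.

Lemma card_odd_cycles_meeting s X :
  (#|[set C in odd_cycles s | ~~ [disjoint C & X]]| <= #|X|)%N.
Proof.
apply: leq_trans (leq_imset_card (porbit s) X); apply: subset_leq_card.
apply/subsetP => C; rewrite !inE -andbA => /and3P[/imsetP[c _ ->] _ /pred0Pn[x /andP[xc xX]]].
by apply/imsetP; exists x => //; apply/eqP; rewrite eq_porbit_mem porbit_sym.
Qed.

(** The cycles that avoid X are the same for s and t, at most three odd cycles
    meet X, and the numbers of odd cycles of s and t have the same parity. *)
Lemma odd_cycles_perturb s t X : {in ~: X, s =1 t} -> (#|X| <= 3)%N ->
  (#|odd_cycles s| <= #|odd_cycles t| + 2)%N.
Proof.
move=> st X3.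
have split_card s' : #|odd_cycles s'| = (#|[set C in odd_cycles s' | [disjoint C & X]]|
   + #|[set C in odd_cycles s' | ~~ [disjoint C & X]]|)%N.
  rewrite -(cardsID [set C : {set T} | [disjoint C & X]] (odd_cycles s')).
  by congr (_ + _)%N; apply: eq_card => C; rewrite !inE // andbC.
have := odd_card_odd_cycles s; rewrite -(odd_card_odd_cycles t).
have := card_odd_cycles_meeting s X; have := card_odd_cycles_meeting t X.
rewrite (split_card s) (split_card t) (odd_cycles_local st).
move: X3; move: #|_| #|_| #|_| #|_| => x a a' b; lia.
Qed.

Lemma odd_cycles1 : #|odd_cycles 1| = #|T|.
Proof.
have -> : odd_cycles 1 = [set [set x] | x in [set: T]].
  apply/setP => C; rewrite inE; apply/andP/imsetP => [[/imsetP[x _ ->] _]|[x _ ->]].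
    by exists x; rewrite // porbit_fix ?perm1.
  by rewrite cards1; split=> //; apply/imsetP; exists x; rewrite // porbit_fix ?perm1.
by rewrite card_imset ?cardsT //; apply: set1_inj.
Qed.

Lemma odd_cycles_all_even s : all_even s -> odd_cycles s = set0.
Proof.
move=> /forall_inP ev; apply/setP => C; rewrite !inE; apply/negbTE/negP.
by case/andP => /ev /negP.
Qed.

Lemma porbitsJ s g : porbits (s ^ g) = [set g @: (C : {set T}) | C in porbits s].
Proof.
have E x : porbit (s ^ g) (g x) = g @: porbit s x.
  apply/setP => z; apply/porbitP/imsetP => [[k ->]|[_ /porbitP[k ->] ->]].
    by exists ((s ^+ k) x); rewrite ?mem_porbit // -conjXg permJ.
  by exists k; rewrite -conjXg permJ.
apply/setP => C; apply/imsetP/imsetP => [[x _ ->]|[_ /imsetP[x _ ->] ->]].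
  by exists (porbit s (g^-1 x)); rewrite ?imset_f // -E permKV.
by exists (g x).
Qed.

Lemma one_cycleJ s g : one_cycle (s ^ g) = one_cycle s.
Proof.
have H s' g' : one_cycle s' -> one_cycle (s' ^ g').
  rewrite /one_cycle => /eqP sT; apply/eqP; rewrite porbitsJ sT imset_set1.
  congr [set _]; apply/setP => x; rewrite inE; apply/imsetP; exists (g'^-1 x) => //.
  by rewrite permKV.
by apply/idP/idP => [/(H _ g^-1)|/H //]; rewrite conjgK.
Qed.

Lemma all_evenJ s g : all_even (s ^ g) = all_even s.
Proof.
have H s' g' : all_even s' -> all_even (s' ^ g').
  move=> /forall_inP ev; apply/forall_inP => D; rewrite porbitsJ => /imsetP[C Cs ->].
  by rewrite card_imset ?ev //; apply: perm_inj.
by apply/idP/idP => [/(H _ g^-1)|/H //]; rewrite conjgK.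
Qed.

End OddCycles.

Section CycleGraph.
Local Open Scope nat_scope.
Local Open Scope group_scope.
Variable N : nat.
Implicit Types (u v : 'S_N).

Definition long_cycle : 'S_N.+1 := perm (@ordS_inj N.+1).
(** The cycle (0 u_1 ... u_N) on {0, ..., N}, with entries numbered from 1:
    lift_perm ord0 ord0 u is the word 0 u_1 ... u_N, and the conjugate of
    long_cycle by it sends each entry to the next one, cyclically. *)
Definition word_cycle u : 'S_N.+1 := long_cycle ^ lift_perm ord0 ord0 u.
(** The cycles correspond to the alternating cycles of the cycle graph of u. *)
Definition cycle_graph_perm u : 'S_N.+1 := word_cycle u * long_cycle^-1.

Lemma long_cycleE (i : 'I_N.+1) : long_cycle i = (i.+1 %% N.+1)%N :> nat.
Proof. by rewrite permE. Qed.

Lemma long_cycle_expg0 k : (k < N.+1)%N -> (long_cycle ^+ k) ord0 = k :> nat.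
Proof.
elim: k => [|k IH] kN; first by rewrite expg0 perm1.
by rewrite expgSr permM long_cycleE IH 1?ltnW // modn_small.
Qed.

Lemma one_cycle_long_cycle : one_cycle long_cycle.
Proof.
have E : porbit long_cycle ord0 = [set: 'I_N.+1].
  apply/setP => i; rewrite inE; apply/porbitP; exists i; apply: val_inj.
  by rewrite /= long_cycle_expg0.
rewrite /one_cycle -E; apply/eqP/setP => C; rewrite inE.
apply/imsetP/eqP => [[x _ ->]|->]; last by exists ord0.
by apply/eqP; rewrite eq_porbit_mem E.
Qed.

(** The word u is recovered by following the cycle from 0. *)
Lemma word_cycle_inj : injective word_cycle.
Proof.
move=> u v; rewrite /word_cycle => uv.
suff H (i : 'I_N.+1) : lift_perm ord0 ord0 u i = lift_perm ord0 ord0 v i.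
  apply/permP => i; apply: (@lift_inj _ ord0); have := H (lift ord0 i).
  by rewrite !lift_perm_lift.
have -> : i = (long_cycle ^+ i) ord0 by apply: val_inj; rewrite /= long_cycle_expg0.
elim: (i : nat) => [|k IH]; first by rewrite expg0 perm1 !lift_perm_id.
by rewrite expgSr permM -[LHS]permJ -[RHS]permJ uv IH.
Qed.

Lemma imset_word_cycle : [set word_cycle u | u : 'S_N] = full_cycles N.+1.
Proof.
apply/eqP; rewrite eqEcard card_imset; last exact: word_cycle_inj.
rewrite card_full_cycles card_Sn leqnn andbT.
apply/subsetP => _ /imsetP[u _ ->]; rewrite inE -/(one_cycle _).
by rewrite one_cycleJ one_cycle_long_cycle.
Qed.

Lemma one_cycleP s : reflect (exists u, s = word_cycle u) (one_cycle s).
Proof.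
apply: (iffP idP) => [s1|[u ->]]; last by rewrite one_cycleJ one_cycle_long_cycle.
have : s \in full_cycles N.+1 by rewrite inE.
by rewrite -imset_word_cycle => /imsetP[u _ ->]; exists u.
Qed.

(** Each full cycle b is conjugate to the inverse of long_cycle, by an element
    that conjugates the full cycles a among themselves; hence all b have the same
    number of partners a. *)
Lemma card_even_products :
  #|[set ab in setX (full_cycles N.+1) (full_cycles N.+1)
        | cycle_lengths_in even_pos (ab.1 * ab.2)]|
  = (N`! * #|[set u | all_even (cycle_graph_perm u)]|)%N.
Proof.
have E : #|[set u | all_even (cycle_graph_perm u)]| =
    #|[set a in full_cycles N.+1 | all_even (a * long_cycle^-1)]|.
  rewrite -(card_imset _ word_cycle_inj); apply: eq_card => a; rewrite [RHS]inE.
  apply/imsetP/andP => [[u ue ->]|[]].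
    by rewrite -imset_word_cycle imset_f //; split=> //; rewrite inE in ue.
  by rewrite -imset_word_cycle => /imsetP[u _ ->] ue; exists u; rewrite ?inE.
rewrite -card_full_cycles E -sum_nat_const.
transitivity (\sum_(b in full_cycles N.+1)
    \sum_(a | (a \in full_cycles N.+1) && all_even (a * b)) 1)%N.
  rewrite pair_big_dep /= -sum1_card.
  rewrite (reindex (fun ab : 'S_N.+1 * 'S_N.+1 => (ab.2, ab.1))) /=; last first.
    by exists (fun ab => (ab.2, ab.1)) => -[].
  apply: eq_bigl => -[b a]; rewrite [LHS]inE in_setX cycle_lengths_even /=.
  by rewrite [LHS]andbAC andbC.
apply: eq_bigr => b b1.
have [u bE] : exists u, b^-1 = word_cycle u.
  by apply/one_cycleP; move: b1; rewrite inE /one_cycle porbitsV.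
have {}bE : b = (long_cycle^-1) ^ lift_perm ord0 ord0 u by rewrite conjVg -[long_cycle ^ _]bE invgK.
rewrite -sum1_card (reindex_inj (conjg_inj (lift_perm ord0 ord0 u))) /=.
apply: eq_bigl => a; rewrite bE -conjMg all_evenJ !inE -!/(one_cycle _) one_cycleJ //.
Qed.

Lemma nth_swap_blocks (T : Type) (x : T) i j k (s : seq T) p :
  (i < j)%N -> (j < k)%N -> (k <= size s)%N ->
  nth x (swap_blocks i j k s) p =
  nth x s (if (p < i)%N then p else if (p < i + (k - j))%N then (p + (j - i))%N
           else if (p < k)%N then (p - (k - j))%N else p).
Proof.
move=> ij jk ks; rewrite /swap_blocks !nth_cat.
rewrite !size_takel ?size_drop; try lia.
case: ltnP => pi; first by rewrite nth_take.
have -> : (p - i < k - j)%N = (p < i + (k - j))%N by lia.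
case: ltnP => pj; first by rewrite nth_take ?nth_drop; [congr nth; lia | lia].
have -> : (p - i - (k - j) < j - i)%N = (p < k)%N by lia.
case: ltnP => pk; first by rewrite nth_take ?nth_drop; [congr nth; lia | lia].
by rewrite nth_drop; congr nth; lia.
Qed.

(* positions in the word 0 u_1 ... u_N *)
(** The position, in the word 0 u_1 ... u_N, of the entry that is at position p
    after the blocks have been exchanged. *)
Definition swap_pos i j k p :=
  (if p <= i then p else if p <= i + (k - j) then p + (j - i)
   else if p <= k then p - (k - j) else p)%N.

Lemma lift_perm_swap u v i j k (P : 'I_N.+1) :
  (i < j)%N -> (j < k)%N -> (k <= N)%N ->
  one_line v = swap_blocks i j k (one_line u) ->
  lift_perm ord0 ord0 v P = lift_perm ord0 ord0 u (inord (swap_pos i j k P)).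
Proof.
move=> ij jk kN uv.
case: (unliftP ord0 P) => [p ->|->]; last first.
  rewrite /swap_pos /= (_ : inord 0 = ord0); last by apply: val_inj; rewrite /= inordK.
  by rewrite !lift_perm_id.
pose r := (swap_pos i j k p.+1).-1.
have pN := ltn_ord p.
have rN : (r < N)%N by rewrite /r /swap_pos; do ?case: ifP; lia.
have -> : inord (swap_pos i j k (lift ord0 p)) = lift ord0 (Ordinal rN).
  have E : swap_pos i j k (lift ord0 p) = r.+1.
    rewrite (_ : (lift ord0 p : nat) = p.+1) //.
    rewrite /r /swap_pos; do ?case: ifP; lia.
  by apply: val_inj; rewrite E /= inordK.
rewrite !lift_perm_lift; congr lift.
rewrite -[v p](nth_one_line v p) uv nth_swap_blocks ?size_one_line //.
rewrite -[u _](nth_one_line u p) /=; congr nth; rewrite /r /swap_pos.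
by case: (ltnP p i); case: (ltnP p (i + (k - j))); case: (ltnP p k) => /=; lia.
Qed.

Lemma swap_pos_lt i j k p :
  (i < j)%N -> (j < k)%N -> (k <= N)%N -> (p < N.+1)%N -> (swap_pos i j k p < N.+1)%N.
Proof.
move=> ij jk kN pN; rewrite /swap_pos.
case: (leqP p i) => ? //; case: (leqP p (i + (k - j))) => ?; first by lia.
by case: (leqP p k) => ?; lia.
Qed.

(** After the exchange, the exceptional positions are the last one before the
    blocks and the last one of each block. *)
Lemma swap_pos_succ i j k p :
  (i < j)%N -> (j < k)%N -> (k <= N)%N -> (p < N.+1)%N ->
  p != i -> p != (i + (k - j))%N -> p != k ->
  swap_pos i j k (p.+1 %% N.+1) = ((swap_pos i j k p).+1 %% N.+1)%N.
Proof.
move=> ij jk kN pN /eqP pi /eqP pj /eqP pk.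
have [pE|p1] := eqVneq p N.
  have E : swap_pos i j k N = N by rewrite /swap_pos !ifF //; apply/negbTE; lia.
  by rewrite pE modnn E modnn.
have pN' : (p.+1 < N.+1)%N by rewrite ltnS ltn_neqAle p1.
suff E : swap_pos i j k p.+1 = (swap_pos i j k p).+1.
  by rewrite modn_small // -E modn_small // swap_pos_lt.
rewrite /swap_pos.
case: (leqP p.+1 i) => ?; first by rewrite ifT //; lia.
rewrite [in RHS]ifF; last by apply/negbTE; lia.
case: (leqP p.+1 (i + (k - j))) => ?; first by rewrite ifT //; lia.
rewrite [in RHS]ifF; last by apply/negbTE; lia.
case: (leqP p.+1 k) => ?; first by rewrite ifT //; lia.
by rewrite ifF //; apply/negbTE; lia.
Qed.

(** Three entries get a new successor. *)
Lemma block_transposition_perturb u v : block_transposition u v ->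
  exists2 X : {set 'I_N.+1}, (#|X| <= 3)%N & {in ~: X, cycle_graph_perm u =1 cycle_graph_perm v}.
Proof.
case/existsP => i /existsP[j /existsP[k /and3P[ij jk /eqP uv]]].
have kN : (k <= N)%N by rewrite -ltnS.
pose vh := lift_perm ord0 ord0 v.
exists [set vh (inord i); vh (inord (i + (k - j))); vh (inord k)].
  apply: leq_trans (leq_card_setU _ _) _; rewrite cards1 addn1 ltnS.
  by rewrite cardsU1 cards1; case: (_ \notin _).
move=> z; have -> : z = vh (vh^-1 z) by rewrite permKV.
move: (vh^-1 z) => P; rewrite !inE !(inj_eq perm_inj) !negb_or -andbA => /and3P[Pi Pj Pk].
have inordN r (Pr : P != inord r) : (r < N.+1)%N -> P != r :> nat.
  by move=> rN; apply: contra Pr => /eqP Pr; apply/eqP/val_inj; rewrite /= inordK.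
rewrite [LHS]permM [RHS]permM; congr (long_cycle^-1 _).
have -> : word_cycle v (vh P) = vh (long_cycle P) by rewrite /word_cycle -/vh permJ.
rewrite /vh !(lift_perm_swap _ ij jk kN uv) /word_cycle permJ; congr (lift_perm _ _ _ _).
have sN Q : (Q < N.+1)%N -> (swap_pos i j k Q < N.+1)%N by apply: swap_pos_lt.
apply: val_inj; rewrite /= long_cycleE !inordK ?sN ?ltn_pmod //.
  by rewrite long_cycleE swap_pos_succ //; apply: inordN => //; lia.
Qed.

(** The identity has N + 1 odd cycles, and each step creates at most two. *)
Lemma sortable_odd_cycles u t : sortable_in u t ->
  (N.+1 <= #|odd_cycles (cycle_graph_perm u)| + 2 * t)%N.
Proof.
case/existsP => -[p /= /eqP <-] /andP[].
elim: p u => [|v p IH] u /=.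
  move=> _ /eqP ->; rewrite /cycle_graph_perm /word_cycle lift_perm1 conjg1 mulgV.
  by rewrite odd_cycles1 card_ord muln0 addn0.
move=> /andP[/block_transposition_perturb[X X3 uv] vp] pl.
have := IH v vp pl.
have : (#|odd_cycles (cycle_graph_perm v)| <= #|odd_cycles (cycle_graph_perm u)| + 2)%N.
  by apply: (odd_cycles_perturb _ X3) => z zX; rewrite uv.
move: #|odd_cycles (cycle_graph_perm v)| #|odd_cycles (cycle_graph_perm u)| (size p) => a b c; lia.
Qed.

Lemma btd_all_even u : all_even (cycle_graph_perm u) -> (uphalf N.+1 <= btd u)%N.
Proof.
move=> ev; rewrite /btd; case: ex_minnP => t /sortable_odd_cycles + _.
by rewrite odd_cycles_all_even // cards0 add0n leq_uphalf_double mul2n.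
Qed.

Theorem hard_permutations (R : numFieldType) :
  (N`!%:R * q R N.+1 even_pos <= #|[set u : 'S_N | (uphalf N.+1 <= btd u)%N]|%:R)%R.
Proof.
rewrite /q card_even_products cardsX card_full_cycles !natrM.
have N0 : (N`!%:R != 0 :> R)%R by rewrite pnatr_eq0 -lt0n fact_gt0.
rewrite -mulf_div mulrCA mulrA mulfV // mul1r mulrCA mulfV // mulr1 ler_nat.
by apply: subset_leq_card; apply/subsetP => u; rewrite !inE => /btd_all_even.
Qed.

End CycleGraph.

(** * Asymptotics *)

From mathcomp Require Import all_classical all_reals all_analysis.
Import numFieldNormedType.Exports.

Section Wallis.
Variable R : realType.

(** The primitive of cos^n that vanishes at 0, by integration by parts; its value
    at pi / 2 is the integral of Wallis. *)
Fixpoint cos_primitive n (x : R) : R :=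
  match n with
  | 0 => x
  | 1 => sin x
  | (n'.+1 as n1).+1 => (cos x ^+ n1 * sin x + n1%:R * cos_primitive n' x) / n1.+1%:R
  end.

Lemma nat_ind2 (P : nat -> Prop) :
  P 0%N -> P 1%N -> (forall n, P n -> P n.+2) -> forall n, P n.
Proof.
move=> P0 P1 P2 n; suff [] : P n /\ P n.+1 by [].
by elim: n => [|n [IH1 IH2]]; split=> //; apply: P2.
Qed.

Lemma is_derive_cos_primitive n (x : R) : is_derive x 1 (cos_primitive n) (cos x ^+ n).
Proof.
elim/nat_ind2: n => [||n IH].
- rewrite expr0; exact: is_derive_id.
- rewrite expr1; exact: is_derive_sin.
have dc := is_deriveX n.+1 (is_derive_cos x).
have dM := is_deriveM dc (is_derive_sin x).
have dS := is_deriveZ (n.+2%:R^-1 : R) (is_deriveD dM (is_deriveZ (n.+1%:R : R) IH)).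
have -> : cos_primitive n.+2 =
    (n.+2%:R^-1 : R) *: ((@cos R) ^+ n.+1 * (@sin R) + (n.+1%:R : R) *: cos_primitive n).
  apply: funext => y; rewrite /= mulrC; congr (_ * (_ + _)).
  by rewrite -[RHS]/(((@cos R) ^+ n.+1) y * sin y) exprfctE.
apply: (is_derive_eq dS).
rewrite !exprfctE /= /GRing.scale /=.
have S2 : sin x * sin x = 1 - cos x * cos x by rewrite -(cos2Dsin2 x); ring.
have n2 : n.+2%:R != 0 :> R by rewrite pnatr_eq0.
apply: (mulfI n2); rewrite mulVKf // !exprS -[n.+2%:R]natr1.
move: (n.+1%:R) => t.
transitivity (cos x * cos x ^+ n * cos x - t * cos x ^+ n * (sin x * sin x) + t * cos x ^+ n).
  by ring.
by rewrite S2; ring.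
Qed.

Lemma cos_primitive0 n : cos_primitive n 0 = 0.
Proof.
elim/nat_ind2: n => [||n IH] //=; first exact: sin0.
by rewrite IH sin0 !mulr0 addr0 mul0r.
Qed.

Lemma cos_primitive_pihalfS n :
  cos_primitive n.+2 (pi / 2) = n.+1%:R * cos_primitive n (pi / 2) / n.+2%:R.
Proof. by rewrite /= cos_pihalf expr0n /= mul0r add0r. Qed.

Lemma invsqrt_coef0 : invsqrt_coef R 0 = 1.
Proof. by rewrite /invsqrt_coef bin0 expr0 invr1 mulr1. Qed.

Lemma cos_primitive_pihalf_even m : cos_primitive m.*2 (pi / 2) = invsqrt_coef R m * (pi / 2).
Proof.
elim: m => [|m IH]; first by rewrite invsqrt_coef0 mul1r.
rewrite doubleS cos_primitive_pihalfS IH.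
have H := invsqrt_coefS R m; rewrite -mul2n.
have -> : (2 * m).+1%:R = 2 * m%:R + 1 :> R by rewrite -natr1 natrM.
have -> : (2 * m).+2%:R = 2 * m.+1%:R :> R by rewrite -natrM mulnS.
by rewrite mulrA -H mulrAC mulfK // mulf_neq0 ?pnatr_eq0.
Qed.

Lemma cos_primitive_pihalf_odd m :
  cos_primitive m.*2.+1 (pi / 2) * (m.*2.+1%:R * invsqrt_coef R m) = 1.
Proof.
elim: m => [|m IH]; first by rewrite invsqrt_coef0 /= sin_pihalf !mulr1.
rewrite doubleS cos_primitive_pihalfS.
have H := invsqrt_coefS R m.
have e1 : m.*2.+1%:R = 2 * m%:R + 1 :> R by rewrite -natr1 -mul2n natrM.
have e2 : m.*2.+2%:R = 2 * m.+1%:R :> R by rewrite -natrM -mul2n mulnS.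
have n3 : m.*2.+3%:R != 0 :> R by rewrite pnatr_eq0.
rewrite mulrA divfK // e2 -[RHS]IH e1 -H; ring.
Qed.

Lemma cos_primitive_pihalf_le m :
  cos_primitive m.*2.+1 (pi / 2) <= cos_primitive m.*2 (pi / 2).
Proof.
have pi2 : (0 : R) <= pi / 2 by rewrite divr_ge0 // pi_ge0.
pose f x := cos_primitive m.*2 x - cos_primitive m.*2.+1 x.
have df (x : R) : is_derive x 1 f (cos x ^+ m.*2 - cos x ^+ m.*2.+1).
  by apply: is_deriveB; apply: is_derive_cos_primitive.
have [|c _] := @MVT_segment R f (fun x => cos x ^+ m.*2 - cos x ^+ m.*2.+1)
  0 (pi / 2) pi2 (fun x _ => df x).
  by apply: derivable_within_continuous => x _; case: (df x).
rewrite /f !cos_primitive0 !subr0 => E; rewrite -subr_ge0 E mulr_ge0 //.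
rewrite exprS -{1}[cos c ^+ _]mul1r -mulrBl mulr_ge0 ?subr_ge0 ?cos_le1 //.
by rewrite exprn_even_ge0 // odd_double.
Qed.

(** The integrals W_n of cos^n over [0, pi / 2] decrease with n, so that
    W_(2m) >= W_(2m+1); the first is the coefficient times pi / 2, the second
    the inverse of (2m + 1) times the coefficient. *)
Lemma wallis m : 1 <= invsqrt_coef R m ^+ 2 * (m.*2.+1%:R * (pi / 2)).
Proof.
rewrite -[X in X <= _](cos_primitive_pihalf_odd m).
have c0 : 0 <= m.*2.+1%:R * invsqrt_coef R m by rewrite mulr_ge0 ?divr_ge0 ?exprn_ge0 ?ler0n.
apply: le_trans (ler_wpM2r c0 (cos_primitive_pihalf_le m)) _.
by rewrite cos_primitive_pihalf_even le_eqVlt; apply/orP; left; apply/eqP; ring.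
Qed.
End Wallis.

Section Asymptotics.
Variable R : realType.

Lemma leq_binomial n k : (0 < k)%N -> (k < n)%N -> (n <= 'C(n, k))%N.
Proof.
elim: n k => // n IH [//|k] _; rewrite ltnS leq_eqVlt => /orP[/eqP <-|kn].
  by rewrite binSn.
by rewrite binS -addn1 leq_add ?IH // bin_gt0 ltnW // ltnW //.
Qed.

Lemma invsqrt_coef_ge0 m : 0 <= invsqrt_coef R m.
Proof. by rewrite divr_ge0 ?exprn_ge0 ?ler0n. Qed.

Lemma sqrt_coefN_ge0 k : 0 <= - sqrt_coef R k.+1.
Proof. by rewrite sqrt_coefN_S !mulr_ge0 ?invr_ge0 ?exprn_ge0 ?ler0n. Qed.

Lemma sqrt_coef0 : sqrt_coef R 0 = 1.
Proof. by have := sum_sqrt_coef R 0; rewrite big_ord1 invsqrt_coef0. Qed.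

Lemma sum_sqrt_coefN m : \sum_(j < m) - sqrt_coef R j.+1 = 1 - invsqrt_coef R m.
Proof. by rewrite -sum_sqrt_coef big_ord_recl sqrt_coef0 opprD addrA subrr add0r sumrN. Qed.

Lemma invsqrt_coef_le1 m : invsqrt_coef R m <= 1.
Proof. by rewrite -subr_ge0 -sum_sqrt_coefN sumr_ge0 // => j _; apply: sqrt_coefN_ge0. Qed.

(** The coefficient of x^(m+1) in (1 - x)^(1/2) (1 - x)^(-1/2) is 0. *)
Lemma sqrt_invsqrt_prod m : \sum_(j < m.+1) - sqrt_coef R j.+1 * invsqrt_coef R (m - j) = invsqrt_coef R m.+1.
Proof.
have [_ /(_ m.+1)] := exp_rec_cauchy_prod (exp_rec_sqrt R) (exp_rec_invsqrt R).
rewrite [RHS]big1 => [/eqP|k _]; last by rewrite addNr mul0r.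
rewrite mulf_eq0 pnatr_eq0 /= /cauchy_prod.
rewrite big_ord_recl sqrt_coef0 mul1r subn0 => /eqP E.
apply/eqP; rewrite -subr_eq0 -oppr_eq0 opprB -[X in _ == X]E -sumrN.
apply/eqP; congr (_ + _); apply: eq_bigr => j _.
by rewrite mulNr opprK subSS.
Qed.

(** Without the inverse binomial coefficients the sum over k >= 1 would be
    invsqrt_coef m.  The term k = m vanishes and removes the fraction
    1 / (2m - 1) of it.  For 0 < k < m the binomial coefficient is at least 2m,
    and the numbers - sqrt_coef k add up to at most 1, so that the loss is at
    most 1 / (2m). *)
Lemma q_lower m : (0 < m)%N ->
  m.*2%:R / m.*2.+1%:R * (invsqrt_coef R m * (1 - (2 * m%:R - 1)^-1) - m.*2%:R^-1)
  <= q R m.*2 even_pos.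
Proof.
move=> m_gt0; rewrite q_even // q_formulaE // ler_wpM2l ?divr_ge0 ?ler0n //.
case: m m_gt0 => // m _.
rewrite big_ord_recl bin0 invr1 subrr mulr0 add0r.
rewrite big_ord_recr /= /bump leq0n add1n binn invr1 subrr mulr0 addr0.
have -> : invsqrt_coef R m.+1 * (1 - (2 * m.+1%:R - 1)^-1)
    = \sum_(j < m) - sqrt_coef R j.+1 * invsqrt_coef R (m - j).
  have last_term : - sqrt_coef R m.+1 = invsqrt_coef R m.+1 / (2 * m.+1%:R - 1).
    by rewrite /sqrt_coef mulNr opprK.
  rewrite mulrBr mulr1 -[X in X - _ = _](sqrt_invsqrt_prod m) big_ord_recr /=.
  by rewrite subnn invsqrt_coef0 mulr1 last_term addrK.
have M0 : 0 <= m.+1.*2%:R^-1 :> R by rewrite invr_ge0 ler0n.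
apply: (@le_trans _ _ (\sum_(j < m) (- sqrt_coef R j.+1 * invsqrt_coef R (m - j) - - sqrt_coef R j.+1 * m.+1.*2%:R^-1))).
  rewrite sumrB lerD2l lerN2 -mulr_suml sum_sqrt_coefN -[X in _ <= X]mul1r ler_wpM2r //.
  by rewrite lerBlDr lerDl invsqrt_coef_ge0.
apply: ler_sum => j _; rewrite add1n subSS mulrBr mulr1 lerD2l lerN2 -mulrA.
rewrite ler_wpM2l ?sqrt_coefN_ge0 //.
have jm := ltn_ord j.
have C0 : (m.+1.*2 <= 'C(m.+1.*2, j.+1.*2))%N by apply: leq_binomial; lia.
have Ci : 'C(m.+1.*2, j.+1.*2)%:R^-1 <= m.+1.*2%:R^-1 :> R.
  by rewrite lef_pV2 ?ler_nat // posrE ltr0n //; apply: leq_trans C0.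
by rewrite -[X in _ <= X]mul1r ler_pM ?invsqrt_coef_ge0 ?invsqrt_coef_le1 // invr_ge0 ler0n.
Qed.

(** By Wallis, the square root times invsqrt_coef m is at least
    (2m - 1) / (2m + 1); the other losses are of order 1 / sqrt m. *)
Lemma sqrt_q_lower m : (0 < m)%N ->
  1 - 3 / Num.sqrt m%:R <= Num.sqrt (pi * (m.*2.-1)%:R / 2) * q R m.*2 even_pos.
Proof.
move=> m_gt0; set s := Num.sqrt (pi * _ / 2); set x : R := m%:R.
have x1 : 1 <= x by rewrite ler1n.
have eN : (m.*2.-1)%:R = 2 * x - 1 :> R.
  by rewrite -subn1 natrB ?double_gt0 // -mul2n natrM.
have eM : m.*2%:R = 2 * x :> R by rewrite -mul2n natrM.
have eM1 : m.*2.+1%:R = 2 * x + 1 :> R by rewrite -natr1 eM.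
have pi4 : (pi : R) <= 4 by have := @pihalf_lt2 R; lra.
have pi0 : (0 : R) < pi by exact: pi_gt0.
have s0 : 0 <= s by rewrite sqrtr_ge0.
have s2 : s ^+ 2 = pi * (2 * x - 1) / 2.
  rewrite sqr_sqrtr eN //; apply: divr_ge0 => //; apply: mulr_ge0; first exact: ltW.
  lra.
pose y := Num.sqrt x; have y2 : y ^+ 2 = x by rewrite sqr_sqrtr //; lra.
have y1 : 1 <= y by rewrite -sqrtr1 ler_wsqrtr.
(* The bound to reach is 1 - 4 a - r, which is at least 1 - 3 r by 2 a <= r. *)
pose r := y^-1; pose a := (2 * x + 1)^-1.
have r0 : 0 < r by rewrite invr_gt0; lra.
have r1 : r <= 1 by rewrite invf_le1 //; lra.
have a0 : 0 < a by rewrite invr_gt0; lra.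
have ar : 2 * a <= r.
  rewrite /a /r ler_pdivrMr; last by lra.
  rewrite mulrC ler_pdivlMr; last by lra.
  by rewrite -y2; nra.
have sc : 1 - 2 * a <= s * invsqrt_coef R m.
  have e : 1 - 2 * a = (2 * x - 1) / (2 * x + 1).
    by rewrite /a; field; rewrite gt_eqF //; lra.
  rewrite -ler_sqr ?nnegrE; last 2 first.
  - by rewrite e divr_ge0 //; lra.
  - by rewrite mulr_ge0 ?invsqrt_coef_ge0.
  rewrite exprMn s2; have := wallis R m; rewrite eM1 => W.
  have -> : pi * (2 * x - 1) / 2 * invsqrt_coef R m ^+ 2
      = (1 - 2 * a) * (invsqrt_coef R m ^+ 2 * ((2 * x + 1) * (pi / 2))).
    by rewrite e; field; rewrite gt_eqF //; lra.
  rewrite expr2 ler_wpM2l //; first by rewrite e divr_ge0 //; lra.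
  by apply: le_trans W; lra.
have st : s / (2 * x) <= r.
  rewrite ler_pdivrMr; last by lra.
  have -> : r * (2 * x) = 2 * y by rewrite -y2 /r; field; rewrite gt_eqF //; lra.
  rewrite -ler_sqr ?nnegrE //; last by lra.
  rewrite s2 exprMn y2; nra.
have := ler_wpM2l s0 (q_lower m_gt0); apply: le_trans.
rewrite eM eM1.
have x_ge0 : 0 <= 2 * x - 1 by lra.
have -> : s * (2 * x / (2 * x + 1) * (invsqrt_coef R m * (1 - (2 * x - 1)^-1) - (2 * x)^-1))
    = (1 - a) * (s * invsqrt_coef R m * (1 - (2 * x - 1)^-1) - s / (2 * x)).
  have -> : 1 - a = 2 * x / (2 * x + 1).
    by rewrite /a; field; rewrite gt_eqF //; lra.
  by ring.
have e3 : (1 - 2 * a) * (1 - (2 * x - 1)^-1) = 1 - 3 * a.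
  by rewrite /a; field; rewrite !gt_eqF //; lra.
have d0 : 0 <= 1 - (2 * x - 1)^-1 by rewrite subr_ge0 invf_le1; lra.
have main : 1 - 3 * a - r <= s * invsqrt_coef R m * (1 - (2 * x - 1)^-1) - s / (2 * x).
  by rewrite -e3 lerB // ler_wpM2r.
have a1 : 0 <= 1 - a by lra.
apply: le_trans (ler_wpM2l a1 main); rewrite -/y -/r.
have -> : (1 - a) * (1 - 3 * a - r) = 1 - 4 * a - r + 3 * a ^+ 2 + a * r by ring.
have : 0 <= a ^+ 2 by rewrite sqr_ge0.
have : 0 <= a * r by rewrite mulr_ge0 // ltW.
by lra.
Qed.

(** For odd N = 2m - 1, hard_permutations and sqrt_q_lower bound the term of
    index N from below by 1 - 3 / sqrt m. *)
Theorem liminf_hard_permutations :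
  (1 <= limf_einf
         (fun N : nat =>
            (Num.sqrt (pi * N%:R / 2) *
               (#|[set u : 'S_N | (uphalf N.+1 <= btd u)%N]|%:R / N`!%:R) : R)%:E)
         (within [set N : nat | odd N]%classic \oo%classic))%E.
Proof.
apply/lee_addgt0Pr => e e0.
rewrite limf_einfE.
have [K Ke] : exists K : nat, forall m, (K <= m)%N -> (0 < m)%N -> 3 / Num.sqrt m%:R <= e.
  exists (Num.bound ((3 / e) ^+ 2)) => m Km m0.
  have s_gt0 : 0 < Num.sqrt m%:R :> R by rewrite sqrtr_gt0 ltr0n.
  rewrite ler_pdivrMr // mulrC -ler_pdivrMr //.
  have e3 : 0 <= 3 / e by rewrite divr_ge0 // ltW.
  rewrite -[X in X <= _]ger0_norm // -sqrtr_sqr ler_wsqrtr //.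
  apply: le_trans (ltW (archi_boundP (sqr_ge0 _))) _.
  by rewrite ler_nat.
set V := [set N : nat | odd N /\ (K.*2 <= N)%N]%classic.
apply: (@le_trans _ _ (ereal_inf [set ((Num.sqrt (pi * N%:R / 2) *
               (#|[set u : 'S_N | (uphalf N.+1 <= btd u)%N]|%:R / N`!%:R) : R)%:E) | N in V] + e%:E)%E); last first.
  rewrite leeD2r // ereal_sup_ubound //; exists V => //.
  by exists K.*2 => // N /= KN oN.
rewrite -leeBlDr //; apply: le_ereal_inf_tmp => _ [N [oN KN] <-].
rewrite -EFinB lee_fin.
have mN : N.+1 = (N.+1./2).*2 by rewrite -[LHS]odd_double_half /= oN.
have m0 : (0 < N.+1./2)%N by rewrite -double_gt0 -mN.
apply: le_trans (_ : Num.sqrt (pi * N%:R / 2) * q R N.+1 even_pos <= _); last first.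
  rewrite ler_wpM2l ?sqrtr_ge0 // ler_pdivlMr ?ltr0n ?fact_gt0 // mulrC.
  exact: hard_permutations.
have := sqrt_q_lower m0; rewrite -mN /=; apply: le_trans.
rewrite lerD2l lerN2 Ke // -leq_double -mN; lia.
Qed.

End Asymptotics.

Theorem theorem3p2 (R : realType) :
  [/\ forall M : nat, M \in even_pos ->
        q R M even_pos =
          2 * M%:R / (M.+1%:R * 2 ^+ M) *
          \sum_(k < M.+1) \sum_(l < M.+1 | (k + l == M./2)%N && (1 <= k)%N)
             k%:R^-1 * 'C(2 * (k - 1), k - 1)%:R * 'C(2 * l, l)%:R *
             (1 - 'C(M, 2 * l)%:R^-1),
      forall N : nat, odd N ->
        N`!%:R * q R N.+1 even_pos <=
          #|[set u : 'S_N | (uphalf N.+1 <= btd u)%N]|%:R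
    & (1 <= limf_einf
         (fun N : nat =>
            (Num.sqrt (pi * N%:R / 2) *
               (#|[set u : 'S_N | (uphalf N.+1 <= btd u)%N]|%:R / N`!%:R) : R)%:E)
         (within [set N : nat | odd N]%classic \oo%classic))%E ].
Proof.
split; last exact: liminf_hard_permutations.
- move=> M; rewrite inE => /andP[M_gt0 eM].
  have ME := even_halfK eM; rewrite -ME.
  by apply: q_even; rewrite -double_gt0 ME.
by move=> N _; apply: hard_permutations.
Qed.
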